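(* Let $Q$ be a finite acyclic quiver. Then the representation ring $R(Q)$ has a direct product structure (isomorphism of rings) \[ R(Q)\cong \prod_{x\in \mathrm{PIE}_0}\langle e_x\rangle , \] where $\mathrm{PIE}_0$ is the set of objects of the category $\mathrm{PIE}$ of $Q$, $e_x=L(\delta_x)\in R(Q)$ is the idempotent associated to $x$, and $\langle e_x\rangle$ is the principal ideal of $R(Q)$ generated by $e_x$.
   Context: Quivers are finite: $Q=(Q_0,Q_1,s,t)$ with vertices, arrows, start and terminal functions. Fix a field $K$. Representations of $Q$ (category $\mathrm{rep}(Q)$) are finite dimensional over $K$. Representation ring: $R(Q)$ is the free abelian group on isomorphism classes $[V]$ of representations of $Q$, modulo the subgroup generated by all $[V\oplus W]-[V]-[W]$, with multiplication $[V][W]=[V\otimes W]$, where $\otimes$ is pointwise: $(V\otimes W)_x=V_x\otimes W_x$ with the tensor product of the two maps over each arrow. Its identity is the representation with $K$ at each vertex and the identity map over each arrow. Quivers over $Q$: a morphism of quivers sends vertices to vertices and arrows to arrows, compatibly with $s,t$. A quiver over $Q$ is a pair $(Q',f')$ with $f'\colon Q'\to Q$ a morphism of quivers (the structure map); morphisms of quivers over $Q$ are morphisms of quivers commuting with structure maps. This category is denoted $\downarrow\! Q$. Linearization: $L(Q',f')\in\mathrm{rep}(Q)$ has at $x\in Q_0$ the vector space with basis $\{b_v: v\in Q'_0,\ f'(v)=x\}$, and the map over $\alpha\in Q_1$ is $\sum_{\beta\in f'^{-1}(\alpha)}\varphi_\beta$, where $\varphi_\beta$ sends $b_{s(\beta)}$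 to $b_{t(\beta)}$ and all other basis vectors to $0$. The category PIE: paths include trivial paths. For a subquiver $T\subseteq Q$ (not necessarily full): - $E_T$ is $T$ with the inclusion $T\to Q$ as structure map. - If $T$ has a unique source $t$, $P_T$ has as vertices all paths in $T$ starting at $t$, each mapped to its endpoint in $Q$; there is an arrow $p\to q$ lying over $\alpha\in Q_1$ exactly when $q=p\alpha$ ($\alpha$ an arrow of $T$ appended to the end of $p$). - If $T$ has a unique sink $u$, $I_T$ is defined dually: vertices are all paths in $T$ ending at $u$, each mapped to its starting vertex, with an arrow $p\to q$ lying over $\alpha$ exactly when $p=\alpha q$. PIE is the full subcategory of $\downarrow\! Q$ whose objects are all $P_T$, $I_T$, $E_T$ (when defined) as $T$ varies over nonempty connected subquivers of $Q$; isomorphic ones among these are identified (counted as one object). Idempotents: PIE is a finite acyclic category (the only endomorphisms, and the only isomorphisms, are identities). Write $[x,y]$ for the number of morphisms $x\to y$. The Möbius function $\mu\colon \mathrm{PIE}_0\times\mathrm{PIE}_0\to\mathbb{Z}$ is the inverse matrix of $([x,y])_{x,y}$, i.e. $\sum_z[x,z]\mu(z,y)$ equals $1$ if $x=y$ and $0$ otherwise. In the free abelian group on $\mathrm{PIE}_0$ put $\delta_x=\sum_{z\in\mathrm{PIE}_0}\mu(z,x)\,z$, extend $L$ additively to a map from this group to $R(Q)$, and set $e_x=L(\delta_x)$. Each ideal $\langle e_x\rangle$ is regarded as a ring with identity $e_x$. *)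

(* Defs.v *)
From HB Require Import structures.
From mathcomp Require Import all_boot all_order all_algebra.
From mathcomp Require Import boolp.
From mathcomp Require Import mxtens freeg.

Set Implicit Arguments.
Unset Strict Implicit.
Unset Printing Implicit Defensive.

Import GRing.Theory.
Local Open Scope ring_scope.
Local Open Scope quotient_scope.

Record quiver := Quiver {
  vert : finType;
  arr : finType;
  src : arr -> vert;
  tgt : arr -> vert
}.

Arguments src {q} _.
Arguments tgt {q} _.

Section Paths.
Variable Q : quiver.

(* A path is a pair of a starting vertex and a sequence of arrows, written in
   the order in which they are traversed; (x, [::]) is the trivial path at x. *)
Fixpoint qpath (x : vert Q) (p : seq (arr Q)) : bool :=
  if p is a :: p' then (src a == x) && qpath (tgt a) p' else true.

Definition qend (x : vert Q) (p : seq (arr Q)) : vert Q := last x (map tgt p).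

Definition acyclic : Prop :=
  forall (x : vert Q) (p : seq (arr Q)), qpath x p -> qend x p = x -> p = [::].

(* Paths have to form a finite type, so their length is bounded by the number
   of vertices; for acyclic Q this excludes no path (acyclic_size_qpath). *)
Definition bpath : finType := (vert Q * #|vert Q|.-bseq (arr Q))%type.

Lemma qpath_cat x p q : qpath x (p ++ q) = qpath x p && qpath (qend x p) q.
Proof. by elim: p x => //= a p IH x; rewrite IH andbA. Qed.

Lemma qend_cat x p q : qend x (p ++ q) = qend (qend x p) q.
Proof. by rewrite /qend map_cat last_cat. Qed.

Lemma qpath_rcons x p a :
  qpath x (rcons p a) = qpath x p && (src a == qend x p).
Proof. by rewrite -cats1 qpath_cat /= andbT. Qed.

Lemma qend_rcons x p a : qend x (rcons p a) = tgt a.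
Proof. by rewrite -cats1 qend_cat. Qed.

Lemma acyclic_uniq_qpath x p :
  acyclic -> qpath x p -> uniq (x :: map tgt p).
Proof.
move=> acQ; elim: p x => //= a p IH x /andP[/eqP sa pp].
have /= -> := IH _ pp; rewrite andbT.
apply/negP; rewrite -[_ :: _]/(map tgt (a :: p)) => /mapP[b bp xb].
have qp : qpath x (a :: p) by rewrite /= sa eqxx.
case/path.splitPr: bp qp => p1 p2; rewrite -cat_rcons qpath_cat => /andP[qp1 _].
have := acQ _ _ qp1; rewrite qend_rcons -xb => /(_ erefl).
by case: (p1).
Qed.

Lemma acyclic_size_qpath x p : acyclic -> qpath x p -> (size p < #|vert Q|)%N.
Proof.
move=> acQ /(acyclic_uniq_qpath acQ)/card_uniqP /= e.
by rewrite -(size_map tgt) -e max_card.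
Qed.

End Paths.

Section Rep.
Variables (K : fieldType) (Q : quiver).

(* The space at x is 'rV[K]_(rdim V x), and matrices act on row vectors. *)
Record rep := Rep {
  rdim : vert Q -> nat;
  rmap : forall a : arr Q, 'M[K]_(rdim (src a), rdim (tgt a))
}.

HB.instance Definition _ := gen_eqMixin rep.
HB.instance Definition _ := gen_choiceMixin rep.

Definition rep_iso (V W : rep) : Prop :=
  exists f : forall x, 'M[K]_(rdim V x, rdim W x),
  exists g : forall x, 'M[K]_(rdim W x, rdim V x),
    (forall x, f x *m g x = 1%:M /\ g x *m f x = 1%:M) /\
    (forall a : arr Q, rmap V a *m f (tgt a) = f (src a) *m rmap W a).

Definition rsum (V W : rep) : rep :=
  @Rep (fun x => rdim V x + rdim W x)%N
       (fun a => block_mx (rmap V a) 0 0 (rmap W a)).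

Definition rtens (V W : rep) : rep :=
  @Rep (fun x => rdim V x * rdim W x)%N
       (fun a => tensmx (rmap V a) (rmap W a)).

Definition rone : rep := @Rep (fun _ => 1%N) (fun _ => 1%:M).

Lemma rep_iso_refl V : rep_iso V V.
Proof.
by exists (fun _ => 1%:M), (fun _ => 1%:M); split=> *; rewrite ?mulmx1 ?mul1mx.
Qed.

Lemma rep_iso_sym V W : rep_iso V W -> rep_iso W V.
Proof.
case=> f [g [fg fW]]; exists g, f; split=> [x|a]; first by case: (fg x).
have [_ gf] := fg (src a); have [fg' _] := fg (tgt a).
by rewrite -[LHS]mul1mx -gf -!mulmxA (mulmxA _ (rmap W a)) -fW -mulmxA fg' mulmx1.
Qed.

Lemma rep_iso_trans V W U : rep_iso V W -> rep_iso W U -> rep_iso V U.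
Proof.
case=> f [g [fg fW]] [f' [g' [fg' fU]]].
exists (fun x => f x *m f' x), (fun x => g' x *m g x); split=> [x|a].
  have [e1 e2] := fg x; have [e1' e2'] := fg' x; split.
    by rewrite mulmxA -(mulmxA (f x)) e1' mulmx1.
  by rewrite mulmxA -(mulmxA (g' x)) e2 mulmx1.
by rewrite mulmxA fW -mulmxA fU mulmxA.
Qed.

Lemma rep_iso_reindex V W
    (h : forall x, 'I_(rdim V x) -> 'I_(rdim W x))
    (k : forall x, 'I_(rdim W x) -> 'I_(rdim V x)) :
    (forall x, cancel (@h x) (@k x)) -> (forall x, cancel (@k x) (@h x)) ->
    (forall a i j, rmap V a i j = rmap W a (h _ i) (h _ j)) ->
  rep_iso V W.
Proof.
move=> hk kh VW.
exists (fun x => \matrix_(i, j) (h x i == j)%:R),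
       (fun x => \matrix_(j, i) (h x i == j)%:R); split=> [x|a].
  split; apply/matrixP=> i j; rewrite !mxE.
    rewrite (bigD1 (h x i)) //= !mxE eqxx mul1r big1 => [|l nl].
      by rewrite addr0 (can_eq (hk x)) eq_sym.
    by rewrite !mxE eq_sym (negPf nl) mul0r.
  rewrite (bigD1 (k x i)) //= !mxE kh eqxx mul1r big1 => [|l nl].
    by rewrite addr0.
  rewrite !mxE -(can_eq (kh x)) in nl *.
  case: eqP => [e|]; last by rewrite mul0r.
  by rewrite -e hk eqxx in nl.
apply/matrixP=> i j; rewrite !mxE.
rewrite (bigD1 (k _ j)) //= big1 => [|l nl]; last first.
  rewrite !mxE; case: eqP => [e|]; last by rewrite mulr0.
  by rewrite -e hk eqxx in nl.
rewrite [RHS](bigD1 (h _ i)) //= [in RHS]big1 => [|l nl]; last first.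
  by rewrite !mxE eq_sym (negPf nl) mul0r.
by rewrite !mxE kh !eqxx mulr1 mul1r VW kh.
Qed.

Lemma rsum_iso V V' W W' :
  rep_iso V V' -> rep_iso W W' -> rep_iso (rsum V W) (rsum V' W').
Proof.
case=> f [g [fg fW]] [f' [g' [fg' fU]]].
exists (fun x => block_mx (f x) 0 0 (f' x)), (fun x => block_mx (g x) 0 0 (g' x)).
split=> [x|a] /=; last first.
  by rewrite !mulmx_block !(mulmx0, mul0mx, addr0, add0r) fW fU.
have [e1 e2] := fg x; have [e1' e2'] := fg' x.
by split; rewrite !mulmx_block !(mulmx0, mul0mx, addr0, add0r) ?e1 ?e2 ?e1' ?e2'
  -?scalar_mx_block.
Qed.

Lemma tensmx11 m n : tensmx 1%:M 1%:M = 1%:M :> 'M[K]_(m * n).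
Proof.
apply/matrixP=> i j; case: (mxtens_indexP i) => u v; case: (mxtens_indexP j) => w t.
by rewrite tensmxE !mxE -natrM mulnb (can_eq (@mxtens_indexK m n)).
Qed.

Lemma rtens_iso V V' W W' :
  rep_iso V V' -> rep_iso W W' -> rep_iso (rtens V W) (rtens V' W').
Proof.
case=> f [g [fg fW]] [f' [g' [fg' fU]]].
exists (fun x => tensmx (f x) (f' x)), (fun x => tensmx (g x) (g' x)).
split=> [x|a] /=; last by rewrite !tensmx_mul fW fU.
have [e1 e2] := fg x; have [e1' e2'] := fg' x.
by split; rewrite tensmx_mul ?e1 ?e2 ?e1' ?e2' tensmx11.
Qed.

Lemma rtensC V W : rep_iso (rtens V W) (rtens W V).
Proof.
pose h m n (i : 'I_(m * n)) : 'I_(n * m) :=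
  mxtens_index ((mxtens_unindex i).2, (mxtens_unindex i).1).
have hK m n : cancel (@h m n) (@h n m).
  by move=> i; case: (mxtens_indexP i) => u v; rewrite /h !mxtens_indexK.
apply: (@rep_iso_reindex (rtens V W) (rtens W V) (fun x => @h _ _) (fun x => @h _ _)).
- by move=> x; apply: hK.
- by move=> x; apply: hK.
by move=> a i j; rewrite !mxE !mxtens_indexK mulrC.
Qed.

Lemma rtensA V W U : rep_iso (rtens V (rtens W U)) (rtens (rtens V W) U).
Proof.
pose h m n p (i : 'I_(m * (n * p))) : 'I_(m * n * p) :=
  let u := mxtens_unindex i in let v := mxtens_unindex u.2 in
  mxtens_index (mxtens_index (u.1, v.1), v.2).
pose k m n p (i : 'I_(m * n * p)) : 'I_(m * (n * p)) :=
  let u := mxtens_unindex i in let v := mxtens_unindex u.1 in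
  mxtens_index (v.1, mxtens_index (v.2, u.2)).
have hK m n p : cancel (@h m n p) (@k m n p).
  move=> i; case: (mxtens_indexP i) => u v; case: (mxtens_indexP v) => w t.
  by rewrite /h /k !mxtens_indexK.
have kK m n p : cancel (@k m n p) (@h m n p).
  move=> i; case: (mxtens_indexP i) => u v; case: (mxtens_indexP u) => w t.
  by rewrite /h /k !mxtens_indexK.
apply: (@rep_iso_reindex (rtens V (rtens W U)) (rtens (rtens V W) U)
  (fun x => @h _ _ _) (fun x => @k _ _ _)).
- by move=> x; apply: hK.
- by move=> x; apply: kK.
move=> a i j; rewrite /= in i j *.
case: (mxtens_indexP i) => u u'; case: (mxtens_indexP u') => v w.
case: (mxtens_indexP j) => s s'; case: (mxtens_indexP s') => t x.
by rewrite /h !mxtens_indexK !tensmxE mulrA.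
Qed.

Lemma rtens1 V : rep_iso (rtens rone V) V.
Proof.
pose h n (i : 'I_(1 * n)) : 'I_n := (mxtens_unindex i).2.
pose k n (i : 'I_n) : 'I_(1 * n) := mxtens_index (0, i).
apply: (@rep_iso_reindex (rtens rone V) V (fun x => @h _) (fun x => @k _)).
- move=> x i; rewrite /h /k -[RHS]mxtens_unindexK; congr mxtens_index.
  by case: mxtens_unindex => u v; rewrite [u]ord1.
- by move=> x i; rewrite /h /k mxtens_indexK.
by move=> a i j; rewrite !mxE ![(mxtens_unindex _).1]ord1 eqxx mul1r.
Qed.

Lemma rtensD V W U :
  rep_iso (rtens (rsum V W) U) (rsum (rtens V U) (rtens W U)).
Proof.
pose h m n p (i : 'I_((m + n) * p)) : 'I_(m * p + n * p) :=
  let u := mxtens_unindex i in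
  match split u.1 with
  | inl v => lshift _ (mxtens_index (v, u.2))
  | inr v => rshift _ (mxtens_index (v, u.2))
  end.
pose k m n p (i : 'I_(m * p + n * p)) : 'I_((m + n) * p) :=
  match split i with
  | inl v => mxtens_index (lshift _ (mxtens_unindex v).1, (mxtens_unindex v).2)
  | inr v => mxtens_index (rshift _ (mxtens_unindex v).1, (mxtens_unindex v).2)
  end.
have hl m n p (v : 'I_m) (w : 'I_p) :
  h m n p (mxtens_index (lshift _ v, w)) = lshift _ (mxtens_index (v, w)).
  by rewrite /h mxtens_indexK /= (unsplitK (inl v)).
have hr m n p (v : 'I_n) (w : 'I_p) :
  h m n p (mxtens_index (rshift _ v, w)) = rshift _ (mxtens_index (v, w)).
  by rewrite /h mxtens_indexK /= (unsplitK (inr v)).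
have kl m n p (v : 'I_m) (w : 'I_p) :
  k m n p (lshift _ (mxtens_index (v, w))) = mxtens_index (lshift _ v, w).
  by rewrite /k (unsplitK (inl _)) mxtens_indexK.
have kr m n p (v : 'I_n) (w : 'I_p) :
  k m n p (rshift _ (mxtens_index (v, w))) = mxtens_index (rshift _ v, w).
  by rewrite /k (unsplitK (inr _)) mxtens_indexK.
have hK m n p : cancel (@h m n p) (@k m n p).
  move=> i; case: (mxtens_indexP i) => u w; case: (split_ordP u) => v ->.
    by rewrite hl kl.
  by rewrite hr kr.
have kK m n p : cancel (@k m n p) (@h m n p).
  move=> i; case: (split_ordP i) => v ->; case: (mxtens_indexP v) => u w.
    by rewrite kl hl.
  by rewrite kr hr.
apply: (@rep_iso_reindex (rtens (rsum V W) U) (rsum (rtens V U) (rtens W U))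
  (fun x => @h _ _ _) (fun x => @k _ _ _)).
- by move=> x; apply: hK.
- by move=> x; apply: kK.
move=> a i j; rewrite /= in i j *.
case: (mxtens_indexP i) => u w; case: (mxtens_indexP j) => u' w'.
rewrite tensmxE.
case: (split_ordP u) => v ->; case: (split_ordP u') => v' ->;
  rewrite ?hl ?hr ?block_mxEul ?block_mxEur ?block_mxEdl ?block_mxEdr.
- by rewrite tensmxE.
- by rewrite !mxE mul0r.
- by rewrite !mxE mul0r.
by rewrite tensmxE.
Qed.

Definition rep_isob (V W : rep) : bool := `[< rep_iso V W >].

Lemma rep_isob_equiv : equiv_class_of rep_isob.
Proof.
split=> [V|V W|W V U]; first exact/asboolP/rep_iso_refl.
  by apply/asboolP/asboolP => /rep_iso_sym.
by move=> /asboolP VW /asboolP WU; apply/asboolP/(rep_iso_trans VW).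
Qed.

Canonical rep_isob_equivRel := EquivRelPack rep_isob_equiv.
Canonical rep_isob_encModRel := defaultEncModRel rep_isob.

Definition isocl := {eq_quot rep_isob}.
HB.instance Definition _ := Choice.on isocl.
HB.instance Definition _ := Quotient.on isocl.

Definition iso_class (V : rep) : isocl := \pi_isocl V.

Lemma iso_classP V W : iso_class V = iso_class W <-> rep_iso V W.
Proof. by split=> [/eqmodP/asboolP|VW] //; apply/eqmodP/asboolP. Qed.

Lemma repr_iso_class V : rep_iso (repr (iso_class V)) V.
Proof. by apply/iso_classP; rewrite /iso_class reprK. Qed.

Definition isocl_tens (c d : isocl) : isocl := iso_class (rtens (repr c) (repr d)).

Lemma isocl_tensE V W :
  isocl_tens (iso_class V) (iso_class W) = iso_class (rtens V W).
Proof. by apply/iso_classP/rtens_iso; apply: repr_iso_class. Qed.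

Lemma isoclP (P : isocl -> Prop) : (forall V, P (iso_class V)) -> forall c, P c.
Proof. by move=> PV c; rewrite -[c]reprK; apply: PV. Qed.

Lemma isocl_tensA : associative isocl_tens.
Proof.
elim/isoclP=> V; elim/isoclP=> W; elim/isoclP=> U.
by rewrite !isocl_tensE; apply/iso_classP/rtensA.
Qed.

Lemma isocl_tensC : commutative isocl_tens.
Proof.
elim/isoclP=> V; elim/isoclP=> W.
by rewrite !isocl_tensE; apply/iso_classP/rtensC.
Qed.

Lemma isocl_tens1 : left_id (iso_class rone) isocl_tens.
Proof. by elim/isoclP=> V; rewrite isocl_tensE; apply/iso_classP/rtens1. Qed.

(* The free abelian group on the isomorphism classes, with the product
   extending [V][W] = [V (x) W] bilinearly. *)
Definition isofree := {freeg isocl / int}.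
HB.instance Definition _ := GRing.Lmodule.on isofree.

Definition isofree_mul (a b : isofree) : isofree :=
  fglift (fun c => fglift (fun d => (<< isocl_tens c d >> : isofree)) b : isofree) a.

Lemma isofree_ind (P : isofree -> Prop) :
    P 0 -> (forall a b, P a -> P b -> P (a - b)) ->
    (forall V, P << iso_class V >>) ->
  forall a, P a.
Proof.
move=> P0 PB PU a.
have PN b : P b -> P (- b) by move=> Pb; rewrite -sub0r; apply: PB.
have PD b c : P b -> P c -> P (b + c).
  by move=> Pb /PN Pc; rewrite -[c]opprK; apply: PB.
rewrite -[a]freeg_sumE; apply: big_ind => // c _.
have: P << c >> by elim/isoclP: c.
move: (coeff _ _) => z Pc.
rewrite -[z]intz -freegU_mulz.
have PMn n : P (<< c >> *+ n) by elim: n => // n IH; rewrite mulrS; apply: PD.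
by case: z => n; rewrite ?NegzE ?mulrNz -pmulrn //; apply: PN.
Qed.

Lemma isofree_mulBl : forall a b c,
  isofree_mul (a - b) c = isofree_mul a c - isofree_mul b c.
Proof. by move=> a b c; rewrite /isofree_mul lift_is_additive. Qed.

Lemma isofree_mulUU V W :
  isofree_mul << iso_class V >> << iso_class W >> = << iso_class (rtens V W) >>.
Proof. by rewrite /isofree_mul !liftU !scale1r isocl_tensE. Qed.

Lemma isofree_mul0l a : isofree_mul 0 a = 0.
Proof. by have := isofree_mulBl 0 0 a; rewrite !subrr. Qed.

Lemma isofree_mulUBr V a b :
  isofree_mul << iso_class V >> (a - b) =
  isofree_mul << iso_class V >> a - isofree_mul << iso_class V >> b.
Proof. by rewrite /isofree_mul !liftU !scale1r lift_is_additive. Qed.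

Lemma isofree_mulU0 V : isofree_mul << iso_class V >> 0 = 0.
Proof. by have := isofree_mulUBr V 0 0; rewrite !subrr. Qed.

Lemma isofree_mulC : commutative isofree_mul.
Proof.
have H V b : isofree_mul << iso_class V >> b = isofree_mul b << iso_class V >>.
  elim/isofree_ind: b => [|a b IHa IHb|W].
  - by rewrite isofree_mulU0 isofree_mul0l.
  - by rewrite isofree_mulUBr isofree_mulBl IHa IHb.
  by rewrite !isofree_mulUU; congr << _ >>; apply/iso_classP/rtensC.
have mulr0' a : isofree_mul a 0 = 0.
  elim/isofree_ind: a => [|a b IHa IHb|W]; rewrite ?isofree_mul0l ?isofree_mulU0 //.
  by rewrite isofree_mulBl IHa IHb subrr.
have mulBr a b c : isofree_mul a (b - c) = isofree_mul a b - isofree_mul a c.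
  elim/isofree_ind: a => [|a a' IHa IHa'|W].
  - by rewrite !isofree_mul0l subrr.
  - by rewrite !isofree_mulBl IHa IHa' !opprD !opprK addrACA.
  by rewrite isofree_mulUBr.
move=> a b; elim/isofree_ind: a => [|a a' IHa IHa'|V].
- by rewrite isofree_mul0l mulr0'.
- by rewrite isofree_mulBl mulBr IHa IHa'.
exact: H.
Qed.

Lemma isofree_mulDl : left_distributive isofree_mul +%R.
Proof.
move=> a b c; have e : isofree_mul (- b) c = - isofree_mul b c.
  by rewrite -sub0r isofree_mulBl isofree_mul0l sub0r.
by rewrite -[b in LHS]opprK isofree_mulBl e opprK.
Qed.

Lemma isofree_mulA : associative isofree_mul.
Proof.
move=> a b c; elim/isofree_ind: a => [|a a' IHa IHa'|V].
- by rewrite !isofree_mul0l.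
- by rewrite !isofree_mulBl IHa IHa'.
elim/isofree_ind: b => [|b b' IHb IHb'|W].
- by rewrite isofree_mul0l isofree_mulU0 isofree_mul0l.
- by rewrite isofree_mulBl !isofree_mulUBr isofree_mulBl IHb IHb'.
elim/isofree_ind: c => [|c c' IHc IHc'|U].
- by rewrite !isofree_mulU0 [RHS]isofree_mulC isofree_mul0l.
- by rewrite !isofree_mulUBr isofree_mulUU isofree_mulUBr IHc IHc' !isofree_mulUU.
by rewrite !isofree_mulUU; congr << _ >>; apply/iso_classP/rtensA.
Qed.

Lemma isofree_mul1 : left_id << iso_class rone >> isofree_mul.
Proof.
elim/isofree_ind=> [|a b IHa IHb|V].
- by rewrite isofree_mulU0.
- by rewrite isofree_mulUBr IHa IHb.
by rewrite isofree_mulUU; congr << _ >>; apply/iso_classP/rtens1.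
Qed.

HB.instance Definition _ := GRing.Zmodule_isComPzRing.Build isofree
  isofree_mulA isofree_mulC isofree_mul1 isofree_mulDl.

Definition sum_relation (V W : rep) : isofree :=
  << iso_class (rsum V W) >> - << iso_class V >> - << iso_class W >>.

(* The subgroup generated by the elements [V (+) W] - [V] - [W]. *)
Definition sum_relations : {pred isofree} := fun a =>
  `[< forall S : {pred isofree}, zmod_closed S ->
        (forall V W, sum_relation V W \in S) -> a \in S >].

Lemma sum_relations_zmod_closed : zmod_closed sum_relations.
Proof.
split=> [|a b /asboolP Na /asboolP Nb]; apply/asboolP => S Sz SG.
  by case: Sz.
by case: (Sz) => _; apply; [apply: Na | apply: Nb].
Qed.

HB.instance Definition _ :=
  GRing.isZmodClosed.Build isofree sum_relations sum_relations_zmod_closed.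

Lemma sum_relationsMl a b : b \in sum_relations -> a * b \in sum_relations.
Proof.
move=> Nb; elim/isofree_ind: a => [|a a' Na Na'|V].
- by rewrite mul0r rpred0.
- by rewrite mulrBl rpredB.
pose v : isofree := << iso_class V >>; rewrite -/v.
move/asboolP: Nb => /(_ [pred c : isofree | v * c \in sum_relations]).
apply=> [|U W]; first split=> [|c d]; rewrite !inE.
- by rewrite mulr0 rpred0.
- by move=> Nc Nd; rewrite mulrBr rpredB.
suff -> : v * sum_relation U W =
          sum_relation (rtens V U) (rtens V W).
  by apply/asboolP => S _; apply.
rewrite /sum_relation !mulrBr; congr (_ - _ - _); rewrite [LHS]isofree_mulUU //.
congr << _ >>; apply/iso_classP.
apply: rep_iso_trans (rtensC _ _) _; apply: rep_iso_trans (rtensD _ _ _) _.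
by apply: rsum_iso; apply: rtensC.
Qed.

(* ring_quotient's {ideal_quot _} requires a proper ideal; the quotient here is
   the zero ring when Q has no vertices. *)
Definition repring := Quotient.quot sum_relations.
HB.instance Definition _ := GRing.Zmodule.on repring.
HB.instance Definition _ := Quotient.on repring.

Definition repring_mul := lift_op2 repring (@GRing.mul isofree).

Lemma pi_repring_mul : {morph \pi_repring : a b / a * b >-> repring_mul a b}.
Proof.
move=> a b; unlock repring_mul; apply/eqP; rewrite -Quotient.idealrBE.
rewrite -[a * b](addrNK (a * repr (\pi_repring b))) -mulrBr -addrA -mulrBl.
apply: rpredD; last rewrite mulrC.
all: by apply: sum_relationsMl; rewrite Quotient.idealrBE reprK.
Qed.

Lemma repringP (P : repring -> Prop) : (forall a, P (\pi a)) -> forall r, P r.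
Proof. by move=> Pa r; rewrite -[r]reprK; apply: Pa. Qed.

Lemma repring_mulA : associative repring_mul.
Proof.
by elim/repringP=> a; elim/repringP=> b; elim/repringP=> c;
  rewrite -!pi_repring_mul mulrA.
Qed.

Lemma repring_mulC : commutative repring_mul.
Proof.
by elim/repringP=> a; elim/repringP=> b; rewrite -!pi_repring_mul mulrC.
Qed.

Lemma repring_mul1 : left_id (\pi_repring 1) repring_mul.
Proof. by elim/repringP=> a; rewrite -!pi_repring_mul mul1r. Qed.

Lemma repring_mulDl : left_distributive repring_mul +%R.
Proof.
elim/repringP=> a; elim/repringP=> b; elim/repringP=> c.
have piD x y : \pi_repring (x + y) = \pi_repring x + \pi_repring y.
  exact: Quotient.pi_add.
by rewrite -piD -!pi_repring_mul -piD mulrDl.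
Qed.

HB.instance Definition _ := GRing.Zmodule_isComPzRing.Build repring
  repring_mulA repring_mulC repring_mul1 repring_mulDl.

Definition rep_class (V : rep) : repring := \pi_repring << iso_class V >>.

End Rep.

Section Over.
Variable Q : quiver.

Definition is_qmor (Q1 Q2 : quiver) (f0 : vert Q1 -> vert Q2)
    (f1 : arr Q1 -> arr Q2) : bool :=
  [forall a, (src (f1 a) == f0 (src a)) && (tgt (f1 a) == f0 (tgt a))].

Record quiver_over := QuiverOver {
  total :> quiver;
  str0 : vert total -> vert Q;
  str1 : arr total -> arr Q;
  strP : is_qmor str0 str1
}.

Definition is_over_mor (X Y : quiver_over)
    (h : {ffun vert X -> vert Y} * {ffun arr X -> arr Y}) : bool :=
  [&& is_qmor h.1 h.2,
      [forall v, str0 (h.1 v) == str0 v] &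
      [forall a, str1 (h.2 a) == str1 a]].

Definition over_hom (X Y : quiver_over) : finType := {h | @is_over_mor X Y h}.

Definition over_iso (X Y : quiver_over) : bool :=
  [exists h : over_hom X Y, [exists k : over_hom Y X,
     [&& [forall v, (val k).1 ((val h).1 v) == v],
         [forall a, (val k).2 ((val h).2 a) == a],
         [forall v, (val h).1 ((val k).1 v) == v] &
         [forall a, (val h).2 ((val k).2 a) == a]]]].

Lemma over_iso_refl X : over_iso X X.
Proof.
have idP : @is_over_mor X X ([ffun v => v], [ffun a => a]).
  by apply/and3P; split; apply/forallP=> u; rewrite /= ?ffunE ?eqxx.
apply/existsP; exists (exist (@is_over_mor X X) _ idP); apply/existsP; exists (exist (@is_over_mor X X) _ idP).
by apply/and4P; split; apply/forallP=> u; rewrite /= !ffunE.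
Qed.

Lemma over_iso_sym X Y : over_iso X Y = over_iso Y X.
Proof.
by apply/existsP/existsP => -[h /existsP[k /and4P[e1 e2 e3 e4]]];
  exists k; apply/existsP; exists h; apply/and4P.
Qed.

Lemma over_mor_comp X Y Z (h : over_hom X Y) (k : over_hom Y Z) :
  @is_over_mor X Z ([ffun v => (val k).1 ((val h).1 v)],
                    [ffun a => (val k).2 ((val h).2 a)]).
Proof.
case: h k => [[h0 h1] /= /and3P[/= /forallP hm /forallP hv /forallP ha]].
case=> [[k0 k1] /= /and3P[/= /forallP km /forallP kv /forallP ka]].
apply/and3P; split; apply/forallP=> u; rewrite /= !ffunE.
- have /andP[/eqP-> /eqP->] := km (h1 u).
  by have /andP[/eqP-> /eqP->] := hm u; rewrite !eqxx.
- by rewrite (eqP (kv _)).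
by rewrite (eqP (ka _)).
Qed.

Lemma over_iso_trans X Y Z : over_iso X Y -> over_iso Y Z -> over_iso X Z.
Proof.
case/existsP=> h /existsP[k /and4P[/forallP e1 /forallP e2 /forallP e3 /forallP e4]].
case/existsP=> h' /existsP[k' /and4P[/forallP e1' /forallP e2' /forallP e3' /forallP e4']].
apply/existsP; exists (exist (@is_over_mor X Z) _ (over_mor_comp h h')).
apply/existsP; exists (exist (@is_over_mor Z X) _ (over_mor_comp k' k)).
apply/and4P; split; apply/forallP=> u; rewrite /= !ffunE.
- by rewrite (eqP (e1' _)).
- by rewrite (eqP (e2' _)).
- by rewrite (eqP (e3 _)).
by rewrite (eqP (e4 _)).
Qed.

Section Linearization.
Variables (K : fieldType) (X : quiver_over).

Definition fiber (x : vert Q) : {set vert X} := [set v | str0 v == x].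

(* The basis vector b_v at x is the row vector indexed by the rank of v in the
   fiber over x. *)
Definition lin_arrow (a : arr Q) (b : arr X) :
    'M[K]_(#|fiber (src a)|, #|fiber (tgt a)|) :=
  \matrix_(i, j) ((enum_val i == src b) && (enum_val j == tgt b))%:R.

Definition linearization : rep K Q :=
  @Rep K Q (fun x => #|fiber x|)
    (fun a => \sum_(b : arr X | str1 b == a) lin_arrow a b).

End Linearization.

Definition is_subquiver (T : {set vert Q} * {set arr Q}) : bool :=
  [forall a in T.2, (src a \in T.1) && (tgt a \in T.1)].

Definition subquiver : finType := {T | is_subquiver T}.

Definition sub_vert (T : subquiver) : {set vert Q} := (val T).1.
Definition sub_arr (T : subquiver) : {set arr Q} := (val T).2.

Definition adjacent (T : subquiver) : rel (vert Q) := fun x y =>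
  [exists a in sub_arr T, ((src a == x) && (tgt a == y)) ||
                          ((src a == y) && (tgt a == x))].

Definition connected_nonempty (T : subquiver) : bool :=
  (sub_vert T != set0) &&
  [forall x in sub_vert T, [forall y in sub_vert T, connect (adjacent T) x y]].

Definition sources (T : subquiver) : {set vert Q} :=
  [set x in sub_vert T | [forall a in sub_arr T, tgt a != x]].

Definition sinks (T : subquiver) : {set vert Q} :=
  [set x in sub_vert T | [forall a in sub_arr T, src a != x]].

Definition path_in (T : subquiver) (p : bpath Q) : bool :=
  [&& p.1 \in sub_vert T, all [in sub_arr T] p.2 & qpath p.1 p.2].

Section Objects.
Variable T : subquiver.

Definition E_quiver : quiver :=
  @Quiver {x | x \in sub_vert T} {a | a \in sub_arr T}
    (fun a => exist _ (src (val a)) (proj1 (andP (implyP (forallP (valP T) (val a)) (valP a)))))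
    (fun a => exist _ (tgt (val a)) (proj2 (andP (implyP (forallP (valP T) (val a)) (valP a))))).

Lemma E_strP :
  @is_qmor E_quiver Q (fun v : vert E_quiver => val v) (fun a : arr E_quiver => val a).
Proof. by apply/forallP=> a /=; rewrite !eqxx. Qed.

Definition E_over : quiver_over := QuiverOver E_strP.

(* P_T, for t the unique source of T *)
Section P.
Variable t : vert Q.

Definition P_vert : finType := {p : bpath Q | path_in T p && (p.1 == t)}.

Definition P_arr : finType :=
  {pqa : P_vert * P_vert * arr Q |
     ((val pqa.1.2).2 : seq (arr Q)) == rcons (val pqa.1.1).2 pqa.2}.

Definition P_quiver : quiver :=
  @Quiver P_vert P_arr (fun b => (val b).1.1) (fun b => (val b).1.2).

Lemma P_strP : @is_qmor P_quiver Q
  (fun p : P_vert => qend (val p).1 (val p).2) (fun b : P_arr => (val b).2).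
Proof.
apply/forallP => -[[[[[x p] /= Tp] [[y q] /= Tq]] a] /= /eqP qpa].
move: Tp Tq => /andP[_ /eqP xt] /andP[/and3P[_ _ yq] /eqP yt].
by move: yq; rewrite /= in xt yt *; rewrite qpa xt yt qpath_rcons qend_rcons eqxx andbT => /andP[].
Qed.

Definition P_over : quiver_over := QuiverOver P_strP.
End P.

(* I_T, for u the unique sink of T *)
Section I.
Variable u : vert Q.

Definition I_vert : finType :=
  {p : bpath Q | path_in T p && (qend p.1 p.2 == u)}.

Definition I_arr : finType :=
  {pqa : I_vert * I_vert * arr Q |
     [&& (val pqa.1.1).1 == src pqa.2, (val pqa.1.2).1 == tgt pqa.2 &
         ((val pqa.1.1).2 : seq (arr Q)) == pqa.2 :: (val pqa.1.2).2]}.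

Definition I_quiver : quiver :=
  @Quiver I_vert I_arr (fun b => (val b).1.1) (fun b => (val b).1.2).

Lemma I_strP : @is_qmor I_quiver Q
  (fun p : I_vert => (val p).1) (fun b : I_arr => (val b).2).
Proof.
apply/forallP => -[[[p q] a] /= /and3P[pa qa _]].
by rewrite eq_sym pa eq_sym qa.
Qed.

Definition I_over : quiver_over := QuiverOver I_strP.
End I.

End Objects.

(* The three summands name the P_T, the I_T and the E_T; the vertex recorded in
   the first two is the unique source (resp. sink) of T. *)
Definition pie_name : finType :=
  ({Tt : subquiver * vert Q |
      connected_nonempty Tt.1 && (sources Tt.1 == [set Tt.2])} +
   {Tu : subquiver * vert Q |
      connected_nonempty Tu.1 && (sinks Tu.1 == [set Tu.2])} +
   {T : subquiver | connected_nonempty T})%type.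

Definition named_obj (c : pie_name) : quiver_over :=
  match c with
  | inl (inl Tt) => P_over (val Tt).1 (val Tt).2
  | inl (inr Tu) => I_over (val Tu).1 (val Tu).2
  | inr T => E_over (val T)
  end.

Definition name_iso (c d : pie_name) : bool :=
  over_iso (named_obj c) (named_obj d).

Lemma name_iso_equiv : equiv_class_of name_iso.
Proof.
split=> [c|c d|d c e]; first exact: over_iso_refl.
  exact: over_iso_sym.
exact: over_iso_trans.
Qed.

Canonical name_iso_equivRel := EquivRelPack name_iso_equiv.
Canonical name_iso_encModRel := defaultEncModRel name_iso.

(* Isomorphic objects count once: PIE0 is the set of isomorphism classes of
   objects, and pie_obj picks a representative of each. *)
Definition PIE0 := {eq_quot name_iso}.
HB.instance Definition _ := Quotient.on PIE0.
HB.instance Definition _ := [Finite of PIE0 by <:%/].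

Definition pie_obj (x : PIE0) : quiver_over := named_obj (repr x).

Definition hom_matrix : 'M[int]_#|{: PIE0}| :=
  \matrix_(i, j) #|over_hom (pie_obj (enum_val i)) (pie_obj (enum_val j))|%:Z.

Definition mobius (x y : PIE0) : int :=
  invmx hom_matrix (enum_rank x) (enum_rank y).

Definition delta (x : PIE0) : {freeg PIE0 / int} :=
  \sum_(z : PIE0) << mobius z x *g z >>.

Definition lin_ext (K : fieldType) (d : {freeg PIE0 / int}) : repring K Q :=
  \sum_(z : PIE0) rep_class (linearization K (pie_obj z)) *~ coeff z d.

Definition pie_idem (K : fieldType) (x : PIE0) : repring K Q :=
  lin_ext K (delta x).

End Over.

Section IdempotentIdeal.
Variables (R : comPzRingType) (e : R).

Definition principal_ideal : {pred R} := fun r => `[< exists a, r = a * e >].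

Lemma principal_ideal_zmod_closed : zmod_closed principal_ideal.
Proof.
split=> [|_ _ /asboolP[a ->] /asboolP[b ->]]; apply/asboolP.
  by exists 0; rewrite mul0r.
by exists (a - b); rewrite mulrBl.
Qed.

HB.instance Definition _ :=
  GRing.isZmodClosed.Build R principal_ideal principal_ideal_zmod_closed.

Hypothesis ee : e * e = e.

(* The proof of idempotence only serves to select the ring structure with
   identity e. *)
Definition ideal_ring of e * e = e := {r : R | r \in principal_ideal}.

Local Notation I := (ideal_ring ee).

HB.instance Definition _ := [isSub of I for @sval R _].
HB.instance Definition _ := [Choice of I by <:].
HB.instance Definition _ := [SubChoice_isSubZmodule of I by <:].

Fact ideal_one_subproof : e \in principal_ideal.
Proof. by apply/asboolP; exists 1; rewrite mul1r. Qed.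

Fact ideal_mul_subproof (r s : I) : val r * val s \in principal_ideal.
Proof. by case/asboolP: (valP s) => b ->; apply/asboolP; exists (val r * b); rewrite mulrA. Qed.

Definition ideal_one : I := Sub e ideal_one_subproof.
Definition ideal_mul (r s : I) : I := Sub (val r * val s) (ideal_mul_subproof r s).

Fact ideal_mulA : associative ideal_mul.
Proof. by move=> r s t; apply: val_inj; rewrite /= mulrA. Qed.

Fact ideal_mulC : commutative ideal_mul.
Proof. by move=> r s; apply: val_inj; rewrite /= mulrC. Qed.

Fact ideal_mul1 : left_id ideal_one ideal_mul.
Proof.
by move=> r; apply: val_inj => /=; case/asboolP: (valP r) => a ->; rewrite mulrCA ee.
Qed.

Fact ideal_mulDl : left_distributive ideal_mul +%R.
Proof. by move=> r s t; apply: val_inj; rewrite /= mulrDl. Qed.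

HB.instance Definition _ := GRing.Zmodule_isComPzRing.Build I
  ideal_mulA ideal_mulC ideal_mul1 ideal_mulDl.

End IdempotentIdeal.

Section ProductRing.
Variables (I : finType) (A : I -> comPzRingType).

Definition prod_ring := {dffun forall i : I, A i}.
Implicit Types f g h : prod_ring.

HB.instance Definition _ := Choice.on prod_ring.

Definition prod_zero : prod_ring := [ffun i => 0 : A i].
Definition prod_opp f : prod_ring := [ffun i => - f i].
Definition prod_add f g : prod_ring := [ffun i => f i + g i].
Definition prod_one : prod_ring := [ffun i => 1 : A i].
Definition prod_mul f g : prod_ring := [ffun i => f i * g i].

Fact prod_addA : associative prod_add.
Proof. by move=> f g h; apply/ffunP=> i; rewrite !ffunE addrA. Qed.

Fact prod_addC : commutative prod_add.
Proof. by move=> f g; apply/ffunP=> i; rewrite !ffunE addrC. Qed.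

Fact prod_add0 : left_id prod_zero prod_add.
Proof. by move=> f; apply/ffunP=> i; rewrite !ffunE add0r. Qed.

Fact prod_addN : left_inverse prod_zero prod_opp prod_add.
Proof. by move=> f; apply/ffunP=> i; rewrite !ffunE addNr. Qed.

HB.instance Definition _ :=
  GRing.isZmodule.Build prod_ring prod_addA prod_addC prod_add0 prod_addN.

Fact prod_mulA : associative prod_mul.
Proof. by move=> f g h; apply/ffunP=> i; rewrite !ffunE mulrA. Qed.

Fact prod_mulC : commutative prod_mul.
Proof. by move=> f g; apply/ffunP=> i; rewrite !ffunE mulrC. Qed.

Fact prod_mul1 : left_id prod_one prod_mul.
Proof. by move=> f; apply/ffunP=> i; rewrite !ffunE mul1r. Qed.

Fact prod_mulDl : left_distributive prod_mul +%R.
Proof. by move=> f g h; apply/ffunP=> i; rewrite !ffunE mulrDl. Qed.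

HB.instance Definition _ := GRing.Zmodule_isComPzRing.Build prod_ring
  prod_mulA prod_mulC prod_mul1 prod_mulDl.

End ProductRing.

(* Main.v *)
Require Import Defs.
From HB Require Import structures.
From mathcomp Require Import all_boot perm all_algebra boolp mxtens freeg.

(** Morphism counts behave like marks in a Burnside ring. Tensor products of
    linearizations correspond to fibre products over Q, and direct sums to disjoint
    unions. A fibre product of two objects of PIE is a disjoint union of objects of
    PIE, up to isomorphism. Hence the classes L(z), z in PIE, span a subring in
    which L(a) L(b) = sum_z c_z L(z) with [w,a] [w,b] = sum_z c_z [w,z] for all w.
    As the matrix of the numbers [w,z] is invertible over the integers, the e_x,
    whose marks are indicator functions, are orthogonal idempotents with sum 1.

    The components of fibre products are recognized by local properties. P_T is
    connected, has at most one arrow into each vertex, and every arrow of its image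
    in Q lifts uniquely from every vertex over its source; these properties
    characterize the P_T, and dually the I_T, up to isomorphism. The E_T are the
    connected quivers embedded in Q. A component of P_T x I_S has at most one arrow
    into and at most one arrow out of each vertex, so it is a path, which embeds in
    the acyclic quiver Q. *)

Set Implicit Arguments.
Unset Strict Implicit.
Unset Printing Implicit Defensive.

Import GRing.Theory.
Local Open Scope ring_scope.
Local Open Scope quotient_scope.

(** * Gradings *)

(** The form in which acyclicity is used: a height that increases along arrows supports induction
    along arrows in every quiver over [Q], and it can be reversed for the opposite quiver. *)
Definition graded (Q : quiver) : Prop :=
  exists h : vert Q -> nat, forall a : arr Q, (h (src a) < h (tgt a))%N.

Definition step (Q : quiver) : rel (vert Q) :=
  fun x y => [exists a : arr Q, (src a == x) && (tgt a == y)].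

Lemma step_arr (Q : quiver) (a : arr Q) : step (src a) (tgt a).
Proof. by apply/existsP; exists a; rewrite !eqxx. Qed.

Lemma connect_qpath (Q : quiver) (x y : vert Q) :
  connect (@step Q) x y -> exists2 p, qpath x p & qend x p = y.
Proof.
case/connectP=> s; elim: s x => [|z s IH] x /=; first by move=> _ ->; exists [::].
case/andP=> /existsP[a /andP[/eqP sa /eqP ta]] zs ly.
have [p pp ep] := IH z zs ly; exists (a :: p); first by rewrite /= sa eqxx ta.
by rewrite -ep /qend /= ta.
Qed.

(** The height of [x] counts the vertices from which [x] can be reached. It grows strictly along
    [a], since [tgt a] reaches itself but cannot reach [src a] without closing a cycle. *)
Lemma acyclic_graded (Q : quiver) : acyclic Q -> graded Q.
Proof.
move=> acQ; exists (fun x => #|[set y | connect (@step Q) y x]|) => a.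
apply/proper_card/properP; split.
  by apply/subsetP=> y; rewrite !inE => /connect_trans; apply; apply/connect1/step_arr.
exists (tgt a); rewrite !inE ?connect0 //.
apply/negP=> /connect_qpath[p pp ep].
have qp : qpath (src a) (a :: p) by rewrite /= eqxx.
by have := acQ _ _ qp ep.
Qed.

Definition opq (Q : quiver) : quiver := @Quiver (vert Q) (arr Q) tgt src.

Lemma graded_op (Q : quiver) : graded Q -> graded (opq Q).
Proof.
case=> h hlt; exists (fun x : vert Q => \max_y h y - h x)%N => a /=.
by apply: ltn_sub2l (hlt a); apply: leq_trans (hlt a) (leq_bigmax _).
Qed.

(** * Morphisms of quivers over Q *)

Section Hom.
Variable Q : quiver.
Implicit Types X Y Z : quiver_over Q.

Lemma str_src X (b : arr X) : str0 (src b) = src (str1 b).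
Proof. by have /forallP/(_ b)/andP[/eqP-> _] := strP X. Qed.

Lemma str_tgt X (b : arr X) : str0 (tgt b) = tgt (str1 b).
Proof. by have /forallP/(_ b)/andP[_ /eqP->] := strP X. Qed.

Definition is_hom X Y (f0 : vert X -> vert Y) (f1 : arr X -> arr Y) : Prop :=
  [/\ forall b, src (f1 b) = f0 (src b), forall b, tgt (f1 b) = f0 (tgt b),
      forall v, str0 (f0 v) = str0 v & forall b, str1 (f1 b) = str1 b].

Lemma is_over_mor_hom X Y f0 f1 : @is_hom X Y f0 f1 ->
  @is_over_mor Q X Y ([ffun v => f0 v], [ffun b => f1 b]).
Proof.
case=> fs ft f0P f1P; apply/and3P; split; apply/forallP=> u; rewrite !ffunE.
- by rewrite fs ft !eqxx.
- by rewrite f0P.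
by rewrite f1P.
Qed.

Definition mk_hom X Y f0 f1 (f : @is_hom X Y f0 f1) : over_hom X Y :=
  exist (@is_over_mor Q X Y) _ (is_over_mor_hom f).

Lemma homP X Y (f : over_hom X Y) : is_hom (val f).1 (val f).2.
Proof.
case: f => [[f0 f1] /= /and3P[/= /forallP fm /forallP fv /forallP fa]].
by split=> u; apply/eqP; rewrite ?fv ?fa //; case/andP: (fm u).
Qed.

Lemma hom_ext X Y (f g : over_hom X Y) :
  (val f).1 =1 (val g).1 -> (val f).2 =1 (val g).2 -> f = g.
Proof.
move=> e0 e1; apply: val_inj; case: f g e0 e1 => [[f0 f1] fP] [[g0 g1] gP] /= e0 e1.
by congr (_, _); apply/ffunP.
Qed.

Definition comp_hom X Y Z (f : over_hom X Y) (g : over_hom Y Z) : over_hom X Z :=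
  exist (@is_over_mor Q X Z) _ (over_mor_comp f g).

Lemma id_is_hom X : @is_hom X X id id.
Proof. by []. Qed.

Definition id_hom X : over_hom X X := mk_hom (id_is_hom X).

Definition endo_trivial X : Prop :=
  forall f : over_hom X X, (val f).1 =1 id /\ (val f).2 =1 id.

Lemma card_endo X : endo_trivial X -> #|over_hom X X| = 1%N.
Proof.
move=> eX; rewrite -cardsT; apply/eqP/cards1P; exists (id_hom X).
apply/setP=> f; rewrite !inE; apply/esym/eqP; have [f0 f1] := eX f.
by apply: hom_ext => u; rewrite /= ffunE ?f0 ?f1.
Qed.

(** Both composites are endomorphisms, hence identities. The recognition of objects of PIE rests on
    this: one morphism in each direction suffices. *)
Lemma endo_trivial_iso X Y (f : over_hom X Y) (g : over_hom Y X) :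
  endo_trivial X -> endo_trivial Y -> over_iso X Y.
Proof.
move=> eX eY; apply/existsP; exists f; apply/existsP; exists g.
have [] := eX (comp_hom f g); have [] := eY (comp_hom g f) => /= e1 e2 e3 e4.
apply/and4P; split; apply/forallP=> u; apply/eqP.
- by have := e3 u; rewrite ffunE.
- by have := e4 u; rewrite ffunE.
- by have := e1 u; rewrite ffunE.
by have := e2 u; rewrite ffunE.
Qed.

Lemma over_iso_bij X Y : over_iso X Y ->
  exists f : over_hom X Y, bijective (val f).1 /\ bijective (val f).2.
Proof.
case/existsP=> f /existsP[g /and4P[/forallP e1 /forallP e2 /forallP e3 /forallP e4]].
exists f; split; [exists (val g).1|exists (val g).2] => u; apply/eqP;
  [exact: e1|exact: e3|exact: e2|exact: e4].
Qed.

(** An arrow of [Q] has at most one lift ending at a given vertex; [out_det] is the same condition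
    at the start. *)
Definition in_det X : Prop := forall b b' : arr X,
  tgt b = tgt b' -> str1 b = str1 b' -> b = b'.

Definition out_det X : Prop := forall b b' : arr X,
  src b = src b' -> str1 b = str1 b' -> b = b'.

(** The closed sets are the unions of connected components. *)
Definition closed_vert X (A : {set vert X}) : Prop :=
  forall b : arr X, (src b \in A) = (tgt b \in A).

(** Connectedness without walks. The empty quiver qualifies, so a vertex is supplied separately
    wherever nonemptiness matters. *)
Definition conn X : Prop :=
  forall A : {set vert X}, closed_vert A -> forall u v, u \in A -> v \in A.

(** Agreement of [f] and [g] propagates along each arrow in both directions: [out_det] identifies
    lifts leaving a common vertex, [in_det] those entering one. Thus the vertices where they agree
    form a closed set. *)
Lemma hom_unique X Y (f g : over_hom X Y) r :
  conn X -> in_det Y -> out_det Y -> (val f).1 r = (val g).1 r -> f = g.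
Proof.
move=> cX iY oY fgr; have [fs ft _ f1] := homP f; have [gs gt _ g1] := homP g.
have fg b : (val f).1 (src b) = (val g).1 (src b) -> (val f).2 b = (val g).2 b.
  by move=> e; apply: oY; rewrite ?fs ?gs ?f1 ?g1.
have e0 v : (val f).1 v = (val g).1 v.
  suff /cX/(_ r v) : closed_vert [set u | (val f).1 u == (val g).1 u].
    by rewrite !inE fgr eqxx => /(_ isT)/eqP.
  move=> b; rewrite !inE; apply/eqP/eqP => e; first by rewrite -ft -gt (fg b e).
  rewrite -fs -gs; congr src; apply: iY; first by rewrite ft gt.
  by rewrite f1 g1.
by apply: hom_ext => // b; apply: fg.
Qed.

(** A vertex alone in its fibre over [Q] is fixed by every endomorphism. *)
Definition anchor X (r : vert X) : Prop := forall v, str0 v = str0 r -> v = r.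

Lemma anchor_endo_trivial X (r : vert X) :
  conn X -> in_det X -> out_det X -> anchor r -> endo_trivial X.
Proof.
move=> cX iX oX ar f.
suff -> : f = id_hom X by split=> u /=; rewrite ffunE.
apply: (hom_unique (r := r)) => //=; rewrite ffunE; apply: ar.
by have [_ _ -> _] := homP f.
Qed.

Definition embedded X : Prop :=
  injective (@str0 Q X) /\ injective (@str1 Q X).

Definition in_deg1 X : Prop := forall b b' : arr X, tgt b = tgt b' -> b = b'.

(** Unique lifting, from every vertex over the source, of those arrows of [Q] that lie in the image
    of [X]. *)
Definition out_sat X : Prop := out_det X /\
  forall (b : arr X) (v : vert X), str0 v = src (str1 b) ->
    exists2 b', src b' = v & str1 b' = str1 b.

(** Only [r] may lack an incoming arrow. Over a graded quiver, walking backwards from any vertex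
    then ends at [r]. *)
Definition rooted X (r : vert X) : Prop :=
  forall u, u = r \/ exists b : arr X, tgt b = u.

(** * Arborescences over a graded quiver *)

Section Graded.
Hypothesis grQ : graded Q.

Lemma graded_ind X (P : vert X -> Prop) :
  (forall v, (forall b : arr X, tgt b = v -> P (src b)) -> P v) -> forall v, P v.
Proof.
have [h hlt] := grQ => IH v.
have [n] := ubnP (h (str0 v)); elim: n v => // n IHn v; rewrite ltnS => hv.
apply: IH => b bv; apply: IHn; apply: leq_trans hv.
by rewrite -bv str_src str_tgt.
Qed.

Lemma rooted_conn X (r : vert X) : rooted r -> conn X.
Proof.
move=> rX A cA u v uA.
have inA w : (w \in A) = (r \in A).
  elim/(@graded_ind X): w => w IH; case: (rX w) => [->//|[b bw]].
  by rewrite -bw -cA IH.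
by rewrite inA -(inA u).
Qed.

Lemma rooted_source X (r : vert X) :
  rooted r -> anchor r /\ forall b : arr X, tgt b <> r.
Proof.
have [h hlt] := grQ => rX.
(* Every vertex other than [r] lies strictly higher than [r]; this isolates [r] in its fibre and
   forbids arrows into it. *)
suff H v : v = r \/ (h (str0 r) < h (str0 v))%N.
  split=> [v e|b br]; first by case: (H v); rewrite // e ltnn.
  have := hlt (str1 b); rewrite -str_src -str_tgt br.
  by case: (H (src b)) => [->|/ltn_trans lt /lt]; rewrite ltnn.
elim/(@graded_ind X): v => v IH; case: (rX v) => [->|[b bv]]; first by left.
right; have : (h (str0 (src b)) < h (str0 v))%N by rewrite -bv str_src str_tgt.
by case: (IH b bv) => [<-//|]; apply: ltn_trans.
Qed.

(** Recursion along arrows: as a vertex has at most one incoming arrow, its value is computed from a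
    unique predecessor, or is initial if there is none. *)
Lemma forest_rec X (A : Type) (g : arr X -> A -> A) (y0 : vert X -> A) :
  in_deg1 X ->
  exists F : vert X -> A, (forall b, F (tgt b) = g b (F (src b))) /\
    forall v, (forall b : arr X, tgt b <> v) -> F v = y0 v.
Proof.
move=> dX; have [h hlt] := grQ.
(* [n] is fuel. Heights drop at each backward step, so all [n] above the height of [v] give the same
   value. *)
pose fix rec n v {struct n} := if n is m.+1 then
    if [pick b | tgt b == v] is Some b then g b (rec m (src b)) else y0 v
  else y0 v.
have recE n m v : (h (str0 v) < n)%N -> (h (str0 v) < m)%N -> rec n v = rec m v.
  elim: n m v => // n IH [//|m] v /=; rewrite !ltnS => hn hm.
  case: pickP => // b /eqP bv; congr g.
  have hb : (h (str0 (src b)) < h (str0 v))%N by rewrite -bv str_src str_tgt.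
  by apply: IH; [apply: leq_trans hn | apply: leq_trans hm].
exists (fun v => rec (h (str0 v)).+1 v); split=> [b|v nv]; last first.
  by rewrite /=; case: pickP => // b /eqP /nv.
rewrite [LHS]/=; case: pickP => [b' /eqP /dX ->|/(_ b)]; last by rewrite eqxx.
by congr g; apply: recE; rewrite // str_src str_tgt.
Qed.

Lemma conn_rooted X : in_deg1 X -> conn X -> vert X -> exists r : vert X, rooted r.
Proof.
move=> dX cX v.
(* [F] walks back to a vertex without incoming arrow. It is constant on components, hence constant,
   and its value is the root. *)
have [F [Fb F0]] := forest_rec (fun _ y => y) id dX.
have Fc u w : F u = F w.
  have /cX/(_ w u) : closed_vert [set x | F x == F w] by move=> b; rewrite !inE Fb.
  by rewrite !inE eqxx => /(_ isT)/eqP.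
exists (F v) => u; case: (pickP (fun b : arr X => tgt b == u)) => [b /eqP|nb].
  by right; exists b.
left; rewrite (Fc v u) F0 // => b bu.
by have := nb b; rewrite bu eqxx.
Qed.

(** A morphism out of a forest is chosen at the vertices without incoming arrow, then extended by
    lifting one arrow after another to [Y]. *)
Lemma hom_exists X Y : in_deg1 X -> out_sat Y ->
    (forall b : arr X, exists c : arr Y, str1 c = str1 b) ->
    (forall u : vert X, (forall b : arr X, tgt b <> u) ->
       exists y : vert Y, str0 y = str0 u) ->
    vert Y -> inhabited (over_hom X Y).
Proof.
move=> dX [oY sY] labels roots yd.
have /fin_all_exists[y0 y0P] : forall u : vert X, exists y : vert Y,
    (forall b : arr X, tgt b <> u) -> str0 y = str0 u.
  move=> u; case: (pickP (fun b : arr X => tgt b == u)) => [b /eqP bu|nb].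
    (* At a vertex with an incoming arrow nothing is asked of the initial value. *)
    by exists yd => /(_ b).
  case: (roots u) => [b bu|y yu]; last by exists y.
  by have := nb b; rewrite bu eqxx.
(* Lift [b] from [y] and take the target. The default [y] never occurs along [F], whose values lie
   over the right vertices. *)
pose g (b : arr X) (y : vert Y) :=
  if [pick c : arr Y | (src c == y) && (str1 c == str1 b)] is Some c then tgt c
  else y.
have [F [Fb F0]] := forest_rec g y0 dX.
have liftP (b : arr X) : str0 (F (src b)) = str0 (src b) ->
    exists c : arr Y, [/\ src c = F (src b), tgt c = F (tgt b) & str1 c = str1 b].
  move=> e; rewrite Fb /g; case: pickP => [c /andP[/eqP cs /eqP c1]|nc].
    by exists c.
  have [c cb] := labels b; have [|c' cs cl] := sY c (F (src b)).
    by rewrite e str_src cb.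
  by have := nc c'; rewrite cs cl cb !eqxx.
have Fstr v : str0 (F v) = str0 v.
  elim/(@graded_ind X): v => v IH.
  case: (pickP (fun b : arr X => tgt b == v)) => [b /eqP bv|nb].
    have [c [_ ct c1]] := liftP b (IH b bv).
    by rewrite -bv -ct !str_tgt c1.
  have nb' (b : arr X) : tgt b <> v by move=> bv; have := nb b; rewrite bv eqxx.
  by rewrite F0 // y0P.
have /fin_all_exists[G GP] := fun b => liftP b (Fstr (src b)).
by constructor; apply: (@mk_hom X Y F G); split=> // b; have [] := GP b.
Qed.

Lemma rooted_hom X Y (r : vert X) (s : vert Y) :
    in_deg1 X -> out_sat Y -> rooted r -> str0 r = str0 s ->
    (forall b : arr X, exists c : arr Y, str1 c = str1 b) ->
  inhabited (over_hom X Y).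
Proof.
move=> dX sY rX rs labels; apply: hom_exists => // u nu.
by exists s; case: (rX u) => [->//|[b /nu]].
Qed.

Lemma arborescence_endo_trivial X (r : vert X) :
  in_deg1 X -> out_det X -> rooted r -> endo_trivial X.
Proof.
move=> dX oX rX; have [ar _] := rooted_source rX.
apply: anchor_endo_trivial (rooted_conn rX) _ oX ar.
by move=> b b' /dX.
Qed.

End Graded.

End Hom.

(** * Duality *)

Section Opposite.
Variable Q : quiver.
Implicit Types X Y : quiver_over Q.

Lemma op_strP X :
  @is_qmor (opq X) (opq Q) (@str0 Q X : vert X -> vert Q) (@str1 Q X).
Proof. by apply/forallP=> b /=; rewrite str_src str_tgt !eqxx. Qed.

Definition op X : quiver_over (opq Q) := QuiverOver (op_strP X).

Lemma conn_op X : conn X <-> conn (op X).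
Proof.
by split=> cX A cA; apply: cX => b; rewrite [RHS](cA b).
Qed.

Lemma in_deg1_op X :
  in_deg1 (op X) <-> forall b b' : arr X, src b = src b' -> b = b'.
Proof. by []. Qed.

Lemma out_sat_op X : out_sat (op X) <-> in_det X /\
  forall (b : arr X) (v : vert X), str0 v = tgt (str1 b) ->
    exists2 b', tgt b' = v & str1 b' = str1 b.
Proof. by []. Qed.

Lemma rooted_op X (r : vert X) :
  @rooted _ (op X) r <-> forall u, u = r \/ exists b : arr X, src b = u.
Proof. by []. Qed.

End Opposite.

Lemma hom_opP (Q : quiver) (X Y : quiver_over Q) (f : over_hom (op X) (op Y)) :
  @is_hom Q X Y (val f).1 (val f).2.
Proof. by have [fs ft f0 f1] := homP f. Qed.

Lemma over_iso_op (Q : quiver) (X Y : quiver_over Q) :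
  over_iso (op X) (op Y) -> over_iso X Y.
Proof.
case/existsP=> f /existsP[g /and4P[/forallP e1 /forallP e2 /forallP e3 /forallP e4]].
apply/existsP; exists (mk_hom (hom_opP f)); apply/existsP; exists (mk_hom (hom_opP g)).
by apply/and4P; split; apply/forallP=> u; rewrite /= !ffunE.
Qed.

(** * Isomorphism criteria *)

Lemma arborescence_iso (Q : quiver) (X Y : quiver_over Q) (r : vert X) (s : vert Y) :
    graded Q -> in_deg1 X -> in_deg1 Y -> out_sat X -> out_sat Y ->
    rooted r -> rooted s -> str0 r = str0 s ->
    (forall b : arr X, exists c : arr Y, str1 c = str1 b) ->
    (forall c : arr Y, exists b : arr X, str1 b = str1 c) ->
  over_iso X Y.
Proof.
move=> grQ dX dY sX sY rX rY rs XY YX.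
(* With the same labels on both sides, lifting from the roots gives a morphism each way, and
   endomorphisms are trivial. *)
have [f] := rooted_hom grQ dX sY rX rs XY.
have [g] := rooted_hom grQ dY sX rY (esym rs) YX.
apply: (endo_trivial_iso f g).
  by apply: arborescence_endo_trivial rX => //; case: sX.
by apply: arborescence_endo_trivial rY => //; case: sY.
Qed.

Lemma embedded_endo_trivial (Q : quiver) (X : quiver_over Q) :
  embedded X -> endo_trivial X.
Proof.
move=> [X0 X1] f; have [_ _ f0 f1] := homP f.
by split=> u; [apply: X0 | apply: X1].
Qed.

Lemma embedded_iso (Q : quiver) (X Y : quiver_over Q) :
    embedded X -> embedded Y ->
    (forall u : vert X, exists v : vert Y, str0 v = str0 u) ->
    (forall v : vert Y, exists u : vert X, str0 u = str0 v) ->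
    (forall b : arr X, exists c : arr Y, str1 c = str1 b) ->
    (forall c : arr Y, exists b : arr X, str1 b = str1 c) ->
  over_iso X Y.
Proof.
have H (Z W : quiver_over Q) : embedded W ->
    (forall u : vert Z, exists v : vert W, str0 v = str0 u) ->
    (forall b : arr Z, exists c : arr W, str1 c = str1 b) ->
    exists f : over_hom Z W, True.
  move=> [W0 _] /fin_all_exists[f0 f0P] /fin_all_exists[f1 f1P].
  have fP : @is_hom Q Z W f0 f1.
    by split=> // b; apply: W0; rewrite f0P ?str_src ?str_tgt f1P.
  by exists (mk_hom fP).
move=> eX eY X0 Y0 X1 Y1.
have [f _] := H X Y eY X0 X1; have [g _] := H Y X eX Y0 Y1.
by apply: (endo_trivial_iso f g); apply: embedded_endo_trivial.
Qed.

(** The source of an arrow is the only vertex in its fibre, so the arrow is its own lift. This lets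
    an [E_T] be multiplied with a [P_S] without losing the lifting property. *)
Lemma embedded_out_sat (Q : quiver) (X : quiver_over Q) : embedded X -> out_sat X.
Proof.
case=> X0 X1; split=> [b b' _ /X1|b v bv] //.
by exists b => //; apply: X0; rewrite str_src.
Qed.

Lemma embedded_op (Q : quiver) (X : quiver_over Q) : embedded X -> embedded (op X).
Proof. by []. Qed.

(** * Paths *)

Section NamedObjects.
Variables (Q : quiver) (acQ : acyclic Q) (T : subquiver Q).

Let grQ : graded Q := acyclic_graded acQ.

Lemma sub_arrP (a : arr Q) :
  a \in sub_arr T -> (src a \in sub_vert T) && (tgt a \in sub_vert T).
Proof. exact/implyP/(forallP (valP T)). Qed.

(** Acyclicity makes the length bound in [bpath] harmless. *)
Lemma bpath_exists (x : vert Q) (p : seq (arr Q)) :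
  qpath x p -> exists2 q : bpath Q, q.1 = x & q.2 = p :> seq _.
Proof.
by move=> /(acyclic_size_qpath acQ)/ltnW sp; exists (x, Bseq sp).
Qed.

Lemma bpath_inj (p q : bpath Q) : p.1 = q.1 -> p.2 = q.2 :> seq _ -> p = q.
Proof. by case: p q => [x p] [y q] /= -> /val_inj->. Qed.

Section P.
Variable t : vert Q.
Local Notation P := (P_over T t).

Lemma P_vertP (p : vert P) :
  [/\ (val p).1 = t, t \in sub_vert T, {subset ((val p).2 : seq (arr Q)) <= sub_arr T} &
      qpath t (val p).2].
Proof.
case: p => p /= /andP[/and3P[tT pT pp] /eqP e]; move: tT pp; rewrite e.
by split=> //; apply/allP.
Qed.

Lemma P_vert_exists (p : seq (arr Q)) :
    t \in sub_vert T -> {subset p <= sub_arr T} -> qpath t p ->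
  exists v : vert P, (val v).2 = p :> seq _.
Proof.
move=> tT pT pp; have [q q1 q2] := bpath_exists pp.
have qP : path_in T q && (q.1 == t).
  by rewrite /path_in q1 q2 tT pp eqxx !andbT /=; apply/allP.
by exists (exist _ q qP).
Qed.

Lemma P_vert_inj (p q : vert P) : (val p).2 = (val q).2 :> seq _ -> p = q.
Proof.
move=> e; apply/val_inj/bpath_inj => //.
by have [-> _ _ _] := P_vertP p; have [-> _ _ _] := P_vertP q.
Qed.

Lemma P_arrP (b : arr P) :
  (val (tgt b)).2 = rcons (val (src b)).2 (str1 b) :> seq _.
Proof. by case: b => [[[p q] a] /= /eqP]. Qed.

Lemma P_arr_exists (p q : vert P) (a : arr Q) :
    (val q).2 = rcons (val p).2 a :> seq _ ->
  exists b : arr P, [/\ src b = p, tgt b = q & str1 b = a].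
Proof.
move=> /eqP e; have bP : ((val (p, q, a).1.2).2 : seq (arr Q))
    == rcons (val (p, q, a).1.1).2 (p, q, a).2 by [].
by exists (exist _ (p, q, a) bP).
Qed.

Lemma P_arr_inj (b c : arr P) :
  src b = src c -> tgt b = tgt c -> str1 b = str1 c -> b = c.
Proof.
move=> es et e1; apply: val_inj; move: es et e1.
by case: b c => [[[p q] a] bP] [[[p' q'] a'] cP] /= -> -> ->.
Qed.

(** A nontrivial path determines its last arrow and the path before it. *)
Lemma P_in_deg1 : in_deg1 P.
Proof.
move=> b c e; have := P_arrP b.
rewrite e (P_arrP c) => /rcons_inj[/esym/P_vert_inj es e1].
exact: P_arr_inj.
Qed.

Lemma P_out_det : out_det P.
Proof.
move=> b c es e1; apply: P_arr_inj => //; apply: P_vert_inj.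
by rewrite (P_arrP b) (P_arrP c) es e1.
Qed.

Lemma P_label (b : arr P) : str1 b \in sub_arr T.
Proof.
have [_ _ bT _] := P_vertP (tgt b); apply: bT.
by rewrite (P_arrP b) mem_rcons inE eqxx.
Qed.

Lemma P_extend (p : vert P) (a : arr Q) :
    a \in sub_arr T -> str0 p = src a ->
  exists2 b : arr P, src b = p & str1 b = a.
Proof.
move=> aT; rewrite /=; have [-> tT pT pp] := P_vertP p => pa.
have [x||q qE] := @P_vert_exists (rcons (val p).2 a) tT.
- by rewrite mem_rcons inE => /orP[/eqP->|/pT].
- by rewrite qpath_rcons pp pa eqxx.
by have [b [bs _ b1]] := P_arr_exists qE; exists b.
Qed.

Lemma P_out_sat : out_sat P.
Proof.
by split=> [|b v bv]; [apply: P_out_det | apply: P_extend; rewrite ?P_label].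
Qed.

(** The root is the trivial path; any other path is entered by the arrow that appends its last
    arrow. *)
Lemma P_rooted : t \in sub_vert T -> exists2 r : vert P, rooted r & str0 r = t.
Proof.
move=> tT; have [|//|r rE] := @P_vert_exists [::] tT; first by [].
exists r => [u|]; last by rewrite /= rE; have [-> _ _ _] := P_vertP r.
have [ut _ uT up] := P_vertP u; case/lastP E: ((val u).2 : seq _) => [|p a].
  by left; apply: P_vert_inj; rewrite E.
right; rewrite E in uT up; move: up; rewrite qpath_rcons => /andP[pp _].
have [x|q qE] := P_vert_exists tT _ pp.
  by move=> xp; apply: uT; rewrite mem_rcons inE xp orbT.
have [|b [_ bt _]] := @P_arr_exists q u a; first by rewrite E qE.
by exists b.
Qed.
End P.

Section I.
Variable u : vert Q.
Local Notation I := (I_over T u).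

Lemma I_vertP (p : vert I) :
  [/\ qend (val p).1 (val p).2 = u, (val p).1 \in sub_vert T,
      {subset ((val p).2 : seq (arr Q)) <= sub_arr T} & qpath (val p).1 (val p).2].
Proof.
case: p => p /= /andP[/and3P[tT pT pp] /eqP e].
by split=> //; apply/allP.
Qed.

Lemma I_vert_exists (x : vert Q) (p : seq (arr Q)) :
    x \in sub_vert T -> {subset p <= sub_arr T} -> qpath x p -> qend x p = u ->
  exists v : vert I, (val v).1 = x /\ (val v).2 = p :> seq _.
Proof.
move=> xT pT pp pu; have [q q1 q2] := bpath_exists pp.
have qP : path_in T q && (qend q.1 q.2 == u).
  by rewrite /path_in q1 q2 xT pp pu eqxx !andbT /=; apply/allP.
by exists (exist _ q qP).
Qed.

Lemma I_vert_inj (p q : vert I) :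
  (val p).1 = (val q).1 -> (val p).2 = (val q).2 :> seq _ -> p = q.
Proof. by move=> e1 e2; apply/val_inj/bpath_inj. Qed.

Lemma I_arrP (b : arr I) :
  [/\ (val (src b)).1 = src (str1 b), (val (tgt b)).1 = tgt (str1 b) &
      (val (src b)).2 = str1 b :: (val (tgt b)).2 :> seq _].
Proof. by case: b => [[[p q] a] /= /and3P[/eqP ? /eqP ? /eqP ?]]. Qed.

Lemma I_arr_exists (p q : vert I) (a : arr Q) :
    (val p).1 = src a -> (val q).1 = tgt a ->
    (val p).2 = a :: (val q).2 :> seq _ ->
  exists b : arr I, [/\ src b = p, tgt b = q & str1 b = a].
Proof.
move=> /eqP ep /eqP eq /eqP e.
have bP : [&& (val (p, q, a).1.1).1 == src (p, q, a).2,
              (val (p, q, a).1.2).1 == tgt (p, q, a).2 &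
              ((val (p, q, a).1.1).2 : seq (arr Q)) ==
                (p, q, a).2 :: (val (p, q, a).1.2).2] by apply/and3P.
by exists (exist _ (p, q, a) bP).
Qed.

Lemma I_arr_inj (b c : arr I) :
  src b = src c -> tgt b = tgt c -> str1 b = str1 c -> b = c.
Proof.
move=> es et e1; apply: val_inj; move: es et e1.
by case: b c => [[[p q] a] bP] [[[p' q'] a'] cP] /= -> -> ->.
Qed.

(** A nontrivial path determines its first arrow and the path after it. *)
Lemma I_op_in_deg1 : in_deg1 (op I).
Proof.
apply/in_deg1_op=> b c e; have [_ tb sb] := I_arrP b; have [_ tc sc] := I_arrP c.
move/eqP: sb; rewrite e sc eqseq_cons => /andP[/eqP e1 /eqP e2].
by apply: I_arr_inj => //; apply: I_vert_inj; rewrite // tb tc e1.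
Qed.

Lemma I_in_det : in_det I.
Proof.
move=> b c et e1.
have [sb _ sb2] := I_arrP b; have [sc _ sc2] := I_arrP c.
by apply: I_arr_inj => //; apply: I_vert_inj; rewrite ?sb ?sc ?sb2 ?sc2 ?et e1.
Qed.

Lemma I_label (b : arr I) : str1 b \in sub_arr T.
Proof.
have [_ _ bT _] := I_vertP (src b); apply: bT.
by have [_ _ ->] := I_arrP b; rewrite inE eqxx.
Qed.

Lemma I_extend (p : vert I) (a : arr Q) :
    a \in sub_arr T -> str0 p = tgt a ->
  exists2 b : arr I, tgt b = p & str1 b = a.
Proof.
move=> aT /= pa; have [pu pT ps pp] := I_vertP p.
have [||||q [q1 q2]] := @I_vert_exists (src a) (a :: (val p).2).
- by have /andP[] := sub_arrP aT.
- by move=> x; rewrite inE => /orP[/eqP->|/ps].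
- by rewrite /= eqxx -pa.
- by move: pu; rewrite pa.
by have [b [_ bt b1]] := I_arr_exists q1 pa q2; exists b.
Qed.

Lemma I_op_out_sat : out_sat (op I).
Proof.
apply/out_sat_op; split=> [|b v bv]; first exact: I_in_det.
by apply: I_extend => //; apply: I_label.
Qed.

Lemma I_op_rooted :
  u \in sub_vert T -> exists2 r : vert I, @rooted _ (op I) r & str0 r = u.
Proof.
move=> uT; have [||||r [r1 r2]] := @I_vert_exists u [::] => //.
exists r => //; apply/rooted_op=> v; have [vu vT vs vp] := I_vertP v.
case E: ((val v).2 : seq _) => [|a p].
  by left; apply: I_vert_inj; rewrite ?E // r1; move: vu; rewrite E.
right; rewrite E in vu vs vp; case/andP: vp => /eqP av pp.
have aT : a \in sub_arr T by apply: vs; rewrite inE eqxx.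
have [||||q [q1 q2]] := @I_vert_exists (tgt a) p => //.
- by have /andP[] := sub_arrP aT.
- by move=> x xp; apply: vs; rewrite inE xp orbT.
have [||b [bs _ _]] := @I_arr_exists v q a _ q1; rewrite ?E ?q2 //.
by exists b.
Qed.
End I.

Lemma E_embedded : embedded (E_over T).
Proof. by split=> u v; apply: val_inj. Qed.

Lemma E_vert_exists x : x \in sub_vert T -> exists v : vert (E_over T), str0 v = x.
Proof. by move=> xT; exists (exist _ x xT). Qed.

Lemma E_arr_exists a : a \in sub_arr T -> exists b : arr (E_over T), str1 b = a.
Proof. by move=> aT; exists (exist _ a aT). Qed.

Lemma E_conn : connected_nonempty T -> conn (E_over T).
Proof.
case/andP=> _ /forall_inP cT A cA u v uA.
have /forall_inP/(_ _ (valP v)) := cT _ (valP u).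
(* [A] is pushed forward to [Q], because [connect (adjacent T)] relates vertices of [Q]. *)
set B := [pred x | [exists w in A, val w == x]].
have inB (w : vert (E_over T)) : (val w \in B) = (w \in A).
  apply/exists_inP/idP => [[w' w'A /eqP/val_inj <-] //|wA].
  by exists w => //.
have clB : fingraph.closed (adjacent T) B.
  move=> x y; have arrB a : a \in sub_arr T -> (src a \in B) = (tgt a \in B).
    move=> aT; have [b <-] := E_arr_exists aT.
    by rewrite -[src _]/(val (src b)) -[tgt _]/(val (tgt b)) !inB cA.
  by case/exists_inP=> a aT /orP[] /andP[/eqP<- /eqP<-]; rewrite arrB.
by move/(closed_connect clB); rewrite !inB uA => <-.
Qed.

End NamedObjects.

(** * Recognition of the objects of PIE *)

Section Recognition.
Variables (Q : quiver) (acQ : acyclic Q).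
Implicit Types X Y Z : quiver_over Q.

Let grQ : graded Q := acyclic_graded acQ.

Lemma im_subP X : is_subquiver (@str0 Q X @: setT, @str1 Q X @: setT).
Proof.
apply/forall_inP=> _ /imsetP[b _ ->] /=.
by rewrite -str_src -str_tgt !imset_f.
Qed.

(** The image of [X] in [Q]; it is the [T] for which [X] is recognized as [P_T], [I_T] or [E_T]. *)
Definition im_sub X : subquiver Q := exist (@is_subquiver Q) _ (im_subP X).

Lemma im_vert X v : @str0 Q X v \in sub_vert (im_sub X).
Proof. exact: imset_f. Qed.

Lemma im_arr X b : @str1 Q X b \in sub_arr (im_sub X).
Proof. exact: imset_f. Qed.

Lemma im_conn X : conn X -> vert X -> connected_nonempty (im_sub X).
Proof.
move=> cX v; apply/andP; split; first by apply/set0Pn; exists (str0 v); apply: im_vert.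
apply/forall_inP=> _ /imsetP[x _ ->]; apply/forall_inP=> _ /imsetP[y _ ->].
have /cX/(_ x y) : closed_vert
    [set w : vert X | connect (adjacent (im_sub X)) (str0 x) (str0 w)].
  move=> b; rewrite !inE; apply/idP/idP => /connect_trans; apply; apply/connect1;
    by apply/exists_inP; exists (str1 b); rewrite ?im_arr ?str_src ?str_tgt ?eqxx ?orbT.
by rewrite !inE connect0; apply.
Qed.

(** An arrow of the image ending at [str0 r] would come from an arrow of [X] ending at [r], since
    [r] is alone in its fibre. *)
Lemma im_sources X (r : vert X) : rooted r -> sources (im_sub X) = [set str0 r].
Proof.
move=> rX; have [ar nr] := rooted_source grQ rX.
apply/setP=> x; rewrite !inE; apply/andP/eqP.
  case=> /imsetP[v _ ->] /forall_inP nv; case: (rX v) => [->//|[b bv]].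
  by have /eqP[] := nv _ (im_arr b); rewrite -str_tgt bv.
move=> ->; split; first exact: im_vert.
apply/forall_inP=> _ /imsetP[b _ ->]; apply/eqP=> br.
by apply: (nr b); apply: ar; rewrite str_tgt.
Qed.

Lemma im_sinks X (r : vert X) :
  @rooted _ (op X) r -> sinks (im_sub X) = [set str0 r].
Proof.
move=> rX; have [ar nr] := rooted_source (graded_op grQ) rX.
apply/setP=> x; rewrite !inE; apply/andP/eqP.
  case=> /imsetP[v _ ->] /forall_inP nv; case/rooted_op/(_ v): rX => [->//|[b bv]].
  by have /eqP[] := nv _ (im_arr b); rewrite -str_src bv.
move=> ->; split; first exact: im_vert.
apply/forall_inP=> _ /imsetP[b _ ->]; apply/eqP=> br.
by apply: (nr b); apply: ar; rewrite [LHS]str_src.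
Qed.

Lemma named_P X : in_deg1 X -> out_sat X -> conn X -> vert X ->
  exists c : pie_name Q, over_iso X (named_obj c).
Proof.
move=> dX sX cX x; have [r rX] := conn_rooted grQ dX cX x.
set T := im_sub X; set t := str0 r.
have cP : connected_nonempty (T, t).1 && (sources (T, t).1 == [set (T, t).2]).
  by rewrite im_conn //= (im_sources rX).
exists (inl (inl (exist _ (T, t) cP))) => /=.
have [r' rP r't] := P_rooted acQ (im_vert r).
apply: (@arborescence_iso Q X (P_over T t) r r') => //.
- exact: P_in_deg1.
- exact: P_out_sat.
(* Following [X] from its root yields a path in [T] from [t] to the image of each [u]. Hence every
   label of [X] also occurs in [P_T]. *)
- have lift (u : vert X) : exists p : vert (P_over T t), str0 p = str0 u.
    elim/(graded_ind grQ): u => u IH; case: (rX u) => [->|[b bu]]; first by exists r'.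
    have [p pb] := IH b bu; rewrite str_src in pb.
    have [c cp c1] := P_extend acQ (im_arr b) pb.
    by exists (tgt c); rewrite -bu !str_tgt c1.
  move=> b; have [p pb] := lift (src b); rewrite str_src in pb.
  by have [c _ c1] := P_extend acQ (im_arr b) pb; exists c.
by move=> c; have /imsetP[b _ ->] := P_label c; exists b.
Qed.

Lemma named_I X : in_deg1 (op X) -> out_sat (op X) -> conn X -> vert X ->
  exists c : pie_name Q, over_iso X (named_obj c).
Proof.
move=> dX sX cX x.
have [r rX] := conn_rooted (graded_op grQ) dX (proj1 (conn_op X) cX) x.
set T := im_sub X; set t := str0 (r : vert X).
have cP : connected_nonempty (T, t).1 && (sinks (T, t).1 == [set (T, t).2]).
  by rewrite im_conn //= (im_sinks rX).
exists (inl (inr (exist _ (T, t) cP))) => /=.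
have [r' rP r't] := I_op_rooted acQ (im_vert r).
apply: over_iso_op.
apply: (@arborescence_iso (opq Q) (op X) (op (I_over T t)) r r') => //.
- exact: graded_op.
- exact: I_op_in_deg1.
- exact: I_op_out_sat.
- have lift (u : vert X) : exists p : vert (I_over T t), str0 p = str0 u.
    elim/(@graded_ind _ (graded_op grQ) (op X)): u => u IH.
    case/rooted_op/(_ u): rX => [->|[b bu]]; first by exists r'.
    have [p pb] := IH b bu; have {}pb : str0 p = tgt (str1 b) by rewrite -str_tgt.
    have [c cp c1] := I_extend acQ (im_arr b) pb.
    by exists (src c); rewrite -bu !str_src c1.
  move=> b; have [p pb] := lift (tgt (b : arr X)); rewrite str_tgt in pb.
  by have [c _ c1] := I_extend acQ (im_arr b) pb; exists c.
by move=> c; have /imsetP[b _ b1] := @I_label _ T t c; exists b.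
Qed.

Lemma named_E X : embedded X -> conn X -> vert X ->
  exists c : pie_name Q, over_iso X (named_obj c).
Proof.
move=> eX cX x; have cT := im_conn cX x.
exists (inr (exist _ (im_sub X) cT)) => /=.
apply: embedded_iso => //; first exact: E_embedded.
- by move=> u; apply/E_vert_exists/im_vert.
- by move=> v; have /imsetP[u _ e] := valP v; exists u.
- by move=> b; apply/E_arr_exists/im_arr.
by move=> c; have /imsetP[b _ e] := valP c; exists b.
Qed.

Lemma connect_height X (u v : vert X) (h : vert Q -> nat) :
    (forall a : arr Q, (h (src a) < h (tgt a))%N) ->
  connect (@step X) u v -> u = v \/ (h (str0 u) < h (str0 v))%N.
Proof.
move=> hlt /connectP[p]; elim: p u => [|w p IH] u /=; first by move=> _ ->; left.
case/andP=> /existsP[b /andP[/eqP<- /eqP bw]] pp lv; right.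
have lt : (h (str0 (src b)) < h (str0 w))%N by rewrite -bw str_src str_tgt.
by case: (IH w pp lv) => [<-//|]; apply: ltn_trans.
Qed.

(** Of any two vertices one reaches the other, and heights increase strictly on the way, so distinct
    vertices have distinct images. *)
Lemma line_embedded X : in_deg1 X -> in_deg1 (op X) -> conn X -> embedded X.
Proof.
move=> dX /in_deg1_op oX cX.
have cmp u v : connect (@step X) u v \/ connect (@step X) v u.
  have [r rX] := conn_rooted grQ dX cX u.
  elim/(graded_ind grQ): u v => u IH v; case: (rX u) => [->|[b bu]].
    left; elim/(graded_ind grQ): v => v IHv; case: (rX v) => [->//|[b bv]].
    by rewrite -bv; apply: connect_trans (IHv b bv) _; apply/connect1/step_arr.
  have su : step (src b) u by rewrite -bu step_arr.
  case: (IH b bu v) => [/connectP[[|w p] /= pp ->]|bv].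
  - by right; apply: connect1.
  (* The path from [src b] to [v] begins with an arrow leaving [src b], and [b] is the only one; the
     rest of the path starts at [u]. *)
  - case/andP: pp => /existsP[c /andP[/eqP/oX-> /eqP bw]] pp.
    by left; apply/connectP; exists p; rewrite // -bu bw.
  by right; apply: connect_trans bv _; apply: connect1.
have X0 : injective (@str0 Q X).
  have [h hlt] := grQ => u v e.
  by case: (cmp u v) => /(connect_height hlt) [//|]; rewrite e ltnn.
by split=> // b c e; apply: oX; apply: X0; rewrite !str_src e.
Qed.

(** The shapes of [P_T], [I_T], [E_T] and of lines, with no connectedness. The class is stable under
    passing to components and contains the fibre products of objects of PIE; its nonempty connected
    members are isomorphic to objects of PIE. *)
Definition pie_class X : Prop :=
  [\/ in_deg1 X /\ out_sat X, in_deg1 (op X) /\ out_sat (op X),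
      embedded X | in_deg1 X /\ in_deg1 (op X)].

Lemma pie_class_named X : pie_class X -> conn X -> vert X ->
  exists c : pie_name Q, over_iso X (named_obj c).
Proof.
move=> clX cX x; case: clX => [[]|[]|eX|[dX oX]].
- by move=> *; apply: named_P.
- by move=> *; apply: named_I.
- exact: named_E.
by apply: named_E => //; apply: line_embedded.
Qed.

Lemma named_class (c : pie_name Q) :
  [\/ in_deg1 (named_obj c) /\ out_sat (named_obj c),
      in_deg1 (op (named_obj c)) /\ out_sat (op (named_obj c)) |
      embedded (named_obj c)].
Proof.
case: c => [[[[T t] /= ?]|[[T u] /= ?]]|[T /= ?]].
- by constructor 1; split; [apply: P_in_deg1 | apply: P_out_sat].
- by constructor 2; split; [apply: I_op_in_deg1 | apply: I_op_out_sat].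
by constructor 3; apply: E_embedded.
Qed.

Lemma named_conn (c : pie_name Q) :
  [/\ inhabited (vert (named_obj c)), conn (named_obj c) &
      endo_trivial (named_obj c)].
Proof.
case: c => [[[[T t] /= /andP[cT /eqP sT]]|[[T u] /= /andP[cT /eqP sT]]]|[T /= cT]].
- have tT : t \in sub_vert T.
    by have : t \in sources T by [rewrite sT set11]; rewrite inE => /andP[].
  have [r rP _] := P_rooted acQ tT; split; first by constructor.
    exact: rooted_conn rP.
  by apply: arborescence_endo_trivial rP => //; [apply: P_in_deg1 | apply: P_out_det].
- have uT : u \in sub_vert T.
    by have : u \in sinks T by [rewrite sT set11]; rewrite inE => /andP[].
  have [r rI _] := I_op_rooted acQ uT.
  have cI : conn (I_over T u) by apply/conn_op/(rooted_conn (graded_op grQ) rI).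
  have [ar _] := rooted_source (graded_op grQ) rI.
  split=> //; apply: (anchor_endo_trivial cI) ar; first exact: I_in_det.
  by move=> b b' /(I_op_in_deg1 (b := b) (b' := b')).
split; last exact/embedded_endo_trivial/E_embedded.
  by case/andP: cT => /set0Pn[x xT] _; constructor; exists x.
exact: E_conn.
Qed.

End Recognition.

(** * Fibre products and closed subquivers *)

Section Constructions.
Variable Q : quiver.
Implicit Types X Y Z W : quiver_over Q.

Lemma card_hom_leq W X Y (f : over_hom X Y) :
  injective (val f).1 -> injective (val f).2 ->
  (#|over_hom W X| <= #|over_hom W Y|)%N.
Proof.
move=> f0I f1I; apply: (leq_card (fun g => comp_hom g f)) => g g' e.
have e0 v : (val (comp_hom g f)).1 v = (val (comp_hom g' f)).1 v by rewrite e.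
have e1 b : (val (comp_hom g f)).2 b = (val (comp_hom g' f)).2 b by rewrite e.
apply: hom_ext => u; first by have := e0 u; rewrite /= !ffunE => /f0I.
by have := e1 u; rewrite /= !ffunE => /f1I.
Qed.

Lemma card_hom_iso W X Y : over_iso X Y -> #|over_hom W X| = #|over_hom W Y|.
Proof.
have H X' Y' : over_iso X' Y' -> (#|over_hom W X'| <= #|over_hom W Y'|)%N.
  case/over_iso_bij=> f [f0 f1].
  exact: card_hom_leq (bij_inj f0) (bij_inj f1).
by move=> XY; apply/eqP; rewrite eqn_leq !H // over_iso_sym.
Qed.

Section Restriction.
Variables (Z : quiver_over Q) (A : {set vert Z}).

Definition restr_quiver : quiver :=
  @Quiver {v | v \in A} {b : arr Z | (src b \in A) && (tgt b \in A)}
    (fun b => exist _ (src (val b)) (proj1 (andP (valP b))))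
    (fun b => exist _ (tgt (val b)) (proj2 (andP (valP b)))).

Lemma restr_strP : @is_qmor restr_quiver Q
  (fun v : vert restr_quiver => str0 (val v))
  (fun b : arr restr_quiver => str1 (val b)).
Proof. by apply/forallP=> b /=; rewrite str_src str_tgt !eqxx. Qed.

Definition restr : quiver_over Q := QuiverOver restr_strP.

Lemma restr_inclP :
  @is_hom Q restr Z (fun v : vert restr => val v) (fun b : arr restr => val b).
Proof. by []. Qed.

Hypothesis clA : closed_vert A.

Lemma restr_arr (b : arr Z) : src b \in A -> exists c : arr restr, val c = b.
Proof.
move=> sA; have bA : (src b \in A) && (tgt b \in A) by rewrite -clA sA.
by exists (exist _ b bA).
Qed.

Lemma restr_in_deg1 : in_deg1 Z -> in_deg1 restr.
Proof.
move=> dZ b c /(congr1 val) /= e; apply: val_inj; exact: dZ.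
Qed.

Lemma restr_op_in_deg1 : in_deg1 (op Z) -> in_deg1 (op restr).
Proof.
move=> /in_deg1_op dZ; apply/in_deg1_op => b c /(congr1 val) /= e.
by apply: val_inj; apply: dZ.
Qed.

Lemma restr_out_sat : out_sat Z -> out_sat restr.
Proof.
case=> oZ sZ; split=> [b c /(congr1 val) es e1|b v bv].
  by apply: val_inj; apply: oZ.
have [b' b's b'1] := sZ (val b) (val v) bv.
have [|c cb] := @restr_arr b'; first by rewrite b's (valP v).
by exists c; [apply: val_inj; rewrite /= cb | rewrite /= cb].
Qed.

Lemma restr_op_out_sat : out_sat (op Z) -> out_sat (op restr).
Proof.
case/out_sat_op=> oZ sZ; apply/out_sat_op; split=> [b c /(congr1 val) es e1|b v bv].
  by apply: val_inj; apply: oZ.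
have [b' b's b'1] := sZ (val b) (val v) bv.
have [|c cb] := @restr_arr b'; first by rewrite clA b's (valP v).
by exists c; [apply: val_inj; rewrite /= cb | rewrite /= cb].
Qed.

Lemma restr_embedded : embedded Z -> embedded restr.
Proof. by case=> Z0 Z1; split=> u v e; apply: val_inj; [apply: Z0|apply: Z1]. Qed.

Lemma restr_pie_class : pie_class Z -> pie_class restr.
Proof.
case=> [[d s]|[d s]|e|[d d']].
- by constructor 1; split; [apply: restr_in_deg1 | apply: restr_out_sat].
- by constructor 2; split; [apply: restr_op_in_deg1 | apply: restr_op_out_sat].
- by constructor 3; apply: restr_embedded.
by constructor 4; split; [apply: restr_in_deg1 | apply: restr_op_in_deg1].
Qed.

(** The preimage of a closed set is closed, so a morphism from a connected quiver lands in [A] as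
    soon as [w] does. *)
Lemma card_hom_restr W (w : vert W) : conn W ->
  #|over_hom W restr| = #|[set f : over_hom W Z | (val f).1 w \in A]|.
Proof.
move=> cW; pose i := mk_hom restr_inclP.
have iI : injective (fun g : over_hom W restr => comp_hom g i).
  move=> g g' e.
  have e0 v : (val (comp_hom g i)).1 v = (val (comp_hom g' i)).1 v by rewrite e.
  have e1 b : (val (comp_hom g i)).2 b = (val (comp_hom g' i)).2 b by rewrite e.
  by apply: hom_ext => u; apply: val_inj; [have := e0 u | have := e1 u];
    rewrite /= !ffunE.
rewrite -cardsT -(card_imset _ iI); congr #|pred_of_set _|.
apply/setP=> f; rewrite inE; apply/imsetP/idP => [[g _ ->]|fw].
  by rewrite /= !ffunE; case: ((val g).1 w).
have [fs ft f0 f1] := homP f.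
have fA v : (val f).1 v \in A.
  have /cW/(_ w v) : closed_vert [set u | (val f).1 u \in A].
    by move=> b; rewrite !inE -fs -ft clA.
  by rewrite !inE; apply.
have fA1 b : exists c : arr restr, val c = (val f).2 b.
  by apply: restr_arr; rewrite fs.
have [g1 g1P] := fin_all_exists fA1.
pose g0 v : vert restr := exist _ ((val f).1 v) (fA v).
have gP : @is_hom Q W restr g0 g1.
  by split=> [b|b|v|b]; rewrite /= -?f0 -?f1 -?g1P //; apply: val_inj;
    rewrite /= g1P.
exists (mk_hom gP) => //.
by apply: hom_ext => u; rewrite /= !ffunE ?[RHS]g1P.
Qed.

End Restriction.

Lemma closed_vertC Z (A : {set vert Z}) : closed_vert A -> closed_vert (~: A).
Proof. by move=> cA b; rewrite !inE cA. Qed.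

(** Marks at connected quivers are additive over disjoint unions: the image of one vertex decides
    the part. *)
Lemma card_hom_closed Z (A : {set vert Z}) W : closed_vert A ->
  inhabited (vert W) -> conn W ->
  #|over_hom W Z| = (#|over_hom W (restr A)| + #|over_hom W (restr (~: A))|)%N.
Proof.
move=> cA [w] cW; rewrite !(card_hom_restr _ w cW) //; last exact: closed_vertC.
rewrite -[LHS](cardsC [set f : over_hom W Z | (val f).1 w \in A]); congr addn.
by apply: eq_card => f; rewrite !inE.
Qed.

Section FibreProduct.
Variables X Y : quiver_over Q.

Let pvert := {u : vert X * vert Y | str0 u.1 == str0 u.2}.
Let parr := {b : arr X * arr Y | str1 b.1 == str1 b.2}.

Lemma fibprod_src_subproof (b : parr) : str0 (src (val b).1) == str0 (src (val b).2).
Proof. by rewrite !str_src (eqP (valP b)). Qed.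

Lemma fibprod_tgt_subproof (b : parr) : str0 (tgt (val b).1) == str0 (tgt (val b).2).
Proof. by rewrite !str_tgt (eqP (valP b)). Qed.

Definition fibprod_quiver : quiver :=
  @Quiver pvert parr
    (fun b => exist _ (src (val b).1, src (val b).2) (fibprod_src_subproof b))
    (fun b => exist _ (tgt (val b).1, tgt (val b).2) (fibprod_tgt_subproof b)).

Lemma fibprod_strP : @is_qmor fibprod_quiver Q
  (fun u : vert fibprod_quiver => str0 (val u).1)
  (fun b : arr fibprod_quiver => str1 (val b).1).
Proof. by apply/forallP=> b /=; rewrite str_src str_tgt !eqxx. Qed.

Definition fibprod : quiver_over Q := QuiverOver fibprod_strP.

Lemma fibprod_fst_hom : @is_hom Q fibprod X
  (fun u : vert fibprod => (val u).1) (fun b : arr fibprod => (val b).1).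
Proof. by []. Qed.

Lemma fibprod_snd_hom : @is_hom Q fibprod Y
  (fun u : vert fibprod => (val u).2) (fun b : arr fibprod => (val b).2).
Proof. by split=> // u; rewrite /= (eqP (valP u)). Qed.

Lemma fibprod_arr_inj (b c : arr fibprod) :
  (val b).1 = (val c).1 -> (val b).2 = (val c).2 -> b = c.
Proof.
move=> e1 e2; apply: val_inj; move: e1 e2.
by case: b c => [[b1 b2] bP] [[c1 c2] cP] /= -> ->.
Qed.

Lemma fibprod_vert_inj (u v : vert fibprod) :
  (val u).1 = (val v).1 -> (val u).2 = (val v).2 -> u = v.
Proof.
move=> e1 e2; apply: val_inj; move: e1 e2.
by case: u v => [[u1 u2] uP] [[v1 v2] vP] /= -> ->.
Qed.

Lemma fibprod_src (b c : arr fibprod) : src b = src c ->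
  src (val b).1 = src (val c).1 /\ src (val b).2 = src (val c).2.
Proof. by move/(congr1 val) => [-> ->]. Qed.

Lemma fibprod_tgt (b c : arr fibprod) : tgt b = tgt c ->
  tgt (val b).1 = tgt (val c).1 /\ tgt (val b).2 = tgt (val c).2.
Proof. by move/(congr1 val) => [-> ->]. Qed.

Lemma fibprod_str1 (b : arr fibprod) : str1 (val b).1 = str1 (val b).2.
Proof. exact/eqP/(valP b). Qed.

Lemma fibprod_vert_exists (u : vert X) (v : vert Y) : str0 u = str0 v ->
  exists w : vert fibprod, (val w).1 = u /\ (val w).2 = v.
Proof. by move/eqP=> uv; exists (exist _ (u, v) uv). Qed.

Lemma fibprod_arr_exists (b : arr X) (c : arr Y) : str1 b = str1 c ->
  exists d : arr fibprod, (val d).1 = b /\ (val d).2 = c.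
Proof. by move/eqP=> bc; exists (exist _ (b, c) bc). Qed.

(** The target determines the first component of an arrow; the label of that component and the
    target then determine the second. *)
Lemma fibprod_in_deg1l : in_deg1 X -> in_det Y -> in_deg1 fibprod.
Proof.
move=> dX dY b c /fibprod_tgt[e1 e2]; have e := dX _ _ e1.
by apply: fibprod_arr_inj => //; apply: dY; rewrite // -!fibprod_str1 e.
Qed.

Lemma fibprod_in_deg1r : in_det X -> in_deg1 Y -> in_deg1 fibprod.
Proof.
move=> dX dY b c /fibprod_tgt[e1 e2]; have e := dY _ _ e2.
by apply: fibprod_arr_inj => //; apply: dX; rewrite // !fibprod_str1 e.
Qed.

Lemma fibprod_op_in_deg1l : in_deg1 (op X) -> out_det Y -> in_deg1 (op fibprod).
Proof.
move=> /in_deg1_op dX dY; apply/in_deg1_op=> b c /fibprod_src[e1 e2].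
have e := dX _ _ e1.
by apply: fibprod_arr_inj => //; apply: dY; rewrite // -!fibprod_str1 e.
Qed.

Lemma fibprod_op_in_deg1r : out_det X -> in_deg1 (op Y) -> in_deg1 (op fibprod).
Proof.
move=> dX /in_deg1_op dY; apply/in_deg1_op=> b c /fibprod_src[e1 e2].
have e := dY _ _ e2.
by apply: fibprod_arr_inj => //; apply: dX; rewrite // !fibprod_str1 e.
Qed.

Lemma fibprod_out_sat : out_sat X -> out_sat Y -> out_sat fibprod.
Proof.
case=> oX sX [oY sY]; split=> [b c /fibprod_src[s1 s2] e|b v bv].
  by apply: fibprod_arr_inj; [apply: oX | apply: oY; rewrite // -!fibprod_str1].
have [b1 s1 e1] := sX (val b).1 (val v).1 bv.
have [|b2 s2 e2] := sY (val b).2 (val v).2.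
  by rewrite -(eqP (valP v)) -fibprod_str1.
have [|d [d1 d2]] := @fibprod_arr_exists b1 b2; first by rewrite e1 e2 fibprod_str1.
exists d; first by apply: fibprod_vert_inj; rewrite /= ?d1 ?d2.
by rewrite /= d1.
Qed.

Lemma fibprod_op_out_sat : out_sat (op X) -> out_sat (op Y) -> out_sat (op fibprod).
Proof.
case/out_sat_op=> oX sX /out_sat_op[oY sY]; apply/out_sat_op.
split=> [b c /fibprod_tgt[s1 s2] e|b v bv].
  by apply: fibprod_arr_inj; [apply: oX | apply: oY; rewrite // -!fibprod_str1].
have [b1 s1 e1] := sX (val b).1 (val v).1 bv.
have [|b2 s2 e2] := sY (val b).2 (val v).2.
  by rewrite -(eqP (valP v)) -fibprod_str1.
have [|d [d1 d2]] := @fibprod_arr_exists b1 b2; first by rewrite e1 e2 fibprod_str1.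
exists d; first by apply: fibprod_vert_inj; rewrite /= ?d1 ?d2.
by rewrite /= d1.
Qed.

Lemma fibprod_embedded : embedded X -> embedded Y -> embedded fibprod.
Proof.
case=> X0 X1 [Y0 Y1]; split=> [u v e|b c e].
  apply: fibprod_vert_inj; first exact: X0.
  by apply: Y0; rewrite -(eqP (valP u)) -(eqP (valP v)).
by apply: fibprod_arr_inj; [apply: X1 | apply: Y1; rewrite -!fibprod_str1].
Qed.

(** The universal property of the product in the category of quivers over [Q]; it makes marks
    multiplicative. *)
Lemma card_hom_fibprod W :
  #|over_hom W fibprod| = (#|over_hom W X| * #|over_hom W Y|)%N.
Proof.
rewrite -card_prod.
pose p f := (comp_hom f (mk_hom fibprod_fst_hom), comp_hom f (mk_hom fibprod_snd_hom)) :
  (over_hom W X * over_hom W Y)%type.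
have pI : injective p.
  move=> f g fg.
  have f10 v : (val (p f).1).1 v = (val (p g).1).1 v by rewrite fg.
  have f20 v : (val (p f).2).1 v = (val (p g).2).1 v by rewrite fg.
  have f11 b : (val (p f).1).2 b = (val (p g).1).2 b by rewrite fg.
  have f21 b : (val (p f).2).2 b = (val (p g).2).2 b by rewrite fg.
  apply: hom_ext => u.
    by apply: fibprod_vert_inj; [have := f10 u | have := f20 u]; rewrite /= !ffunE.
  by apply: fibprod_arr_inj; [have := f11 u | have := f21 u]; rewrite /= !ffunE.
rewrite -[LHS](card_imset _ pI) -[RHS]cardsT; apply: eq_card => -[f g].
rewrite [RHS]inE; apply/imsetP.
have [fs ft f0 f1] := homP f; have [gs gt g0 g1] := homP g.
have [h0 h0P] : exists h0 : vert W -> vert fibprod,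
    forall v, (val (h0 v)).1 = (val f).1 v /\ (val (h0 v)).2 = (val g).1 v.
  apply: (@fin_all_exists _ _ (fun v w =>
    (val w).1 = (val f).1 v /\ (val w).2 = (val g).1 v)).
  by move=> v; apply: fibprod_vert_exists; rewrite f0 g0.
have [h1 h1P] : exists h1 : arr W -> arr fibprod,
    forall b, (val (h1 b)).1 = (val f).2 b /\ (val (h1 b)).2 = (val g).2 b.
  apply: (@fin_all_exists _ _ (fun v w =>
    (val w).1 = (val f).2 v /\ (val w).2 = (val g).2 v)).
  by move=> v; apply: fibprod_arr_exists; rewrite f1 g1.
have hP : @is_hom Q W fibprod h0 h1.
  split=> b.
  - have [hs hs'] := h0P (src b); have [e e'] := h1P b.
    by apply: fibprod_vert_inj; rewrite /= ?e ?e' ?hs ?hs' ?fs ?gs.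
  - have [hs hs'] := h0P (tgt b); have [e e'] := h1P b.
    by apply: fibprod_vert_inj; rewrite /= ?e ?e' ?hs ?hs' ?ft ?gt.
  - by have [e _] := h0P b; rewrite /= e f0.
  by have [e _] := h1P b; rewrite /= e f1.
exists (mk_hom hP); rewrite ?inE //; congr pair; apply: hom_ext => u; rewrite /= !ffunE.
- by have [] := h0P u.
- by have [] := h1P u.
- by have [] := h0P u.
by have [] := h1P u.
Qed.

End FibreProduct.
End Constructions.

(** * The representation ring *)

Section RepRing.
Variables (K : fieldType) (Q : quiver).
Implicit Types V W : rep K Q.

Lemma rep_class_iso V W : rep_iso V W -> rep_class V = rep_class W.
Proof. by rewrite /rep_class => /iso_classP->. Qed.

Lemma rep_class_sum V W : rep_class (rsum V W) = rep_class V + rep_class W.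
Proof.
have piD (x y : isofree K Q) :
  \pi_(repring K Q) (x + y) = \pi_(repring K Q) x + \pi_(repring K Q) y.
  exact: Quotient.pi_add.
rewrite /rep_class -piD; apply/eqP; rewrite -Quotient.idealrBE opprD addrA.
by apply/asboolP=> S _; apply.
Qed.

Lemma rep_class_tens V W : rep_class (rtens V W) = rep_class V * rep_class W.
Proof. by rewrite /rep_class -isofree_mulUU [LHS]pi_repring_mul. Qed.

(** Both bases are labelled injectively by [B], with the same labels at each vertex and equal matrix
    entries at equal labels. Matching labels replaces explicit bijections between ordinals. *)
Lemma rep_iso_basis (B : Type) V W
    (bV : forall x, 'I_(rdim V x) -> B) (bW : forall x, 'I_(rdim W x) -> B) :
    (forall x, injective (@bV x)) -> (forall x, injective (@bW x)) ->
    (forall x i, exists j, @bW x j = @bV x i) ->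
    (forall x j, exists i, @bV x i = @bW x j) ->
    (forall a i j i' j', bV _ i = bW _ i' -> bV _ j = bW _ j' ->
       rmap V a i j = rmap W a i' j') ->
  rep_iso V W.
Proof.
move=> VI WI VW WV E.
have /fin_all_exists[h hP] : forall x, exists h : 'I_(rdim V x) -> 'I_(rdim W x),
    forall i, bW x (h i) = bV x i.
  by move=> x; apply: (@fin_all_exists _ _ (fun i j => bW x j = bV x i)).
have /fin_all_exists[k kP] : forall x, exists k : 'I_(rdim W x) -> 'I_(rdim V x),
    forall i, bV x (k i) = bW x i.
  by move=> x; apply: (@fin_all_exists _ _ (fun i j => bV x j = bW x i)).
apply: (rep_iso_reindex (h := h) (k := k)).
- by move=> x i; apply: VI; rewrite kP hP.
- by move=> x i; apply: WI; rewrite hP kP.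
by move=> a i j; apply: E; rewrite hP.
Qed.

(** The zero representation is isomorphic to its double, so its class cancels. *)
Lemma rep_class_empty V : (forall x, rdim V x = 0%N) -> rep_class V = 0.
Proof.
move=> V0.
have noV x (i : 'I_(rdim V x)) : False by move: i; rewrite V0 => -[].
suff VV : rep_iso V (rsum V V).
  by apply: (addIr (rep_class V)); rewrite add0r -rep_class_sum -(rep_class_iso VV).
have no2 x (i : 'I_(rdim (rsum V V) x)) : False by case: (split i) => /noV.
apply: (@rep_iso_basis nat _ _ (fun _ _ => 0%N) (fun _ _ => 0%N)).
- by move=> x i; case: (noV _ i).
- by move=> x i; case: (no2 _ i).
- by move=> x i; case: (noV _ i).
- by move=> x i; case: (no2 _ i).
by move=> a i; case: (noV _ i).
Qed.

End RepRing.

(** * Linearization *)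

Section Linearization.
Variables (K : fieldType) (Q : quiver).
Implicit Types X Y Z : quiver_over Q.

Local Notation L := (linearization K).

Definition lifts X (a : arr Q) (u v : vert X) : bool :=
  [exists b : arr X, [&& str1 b == a, src b == u & tgt b == v]].

(** By [out_det] at most one arrow over [a] contributes to a given entry, so the entries are 0 or 1
    and record the existence of a lift. *)
Lemma lin_mapE X a i j : out_det X ->
  rmap (L X) a i j = (lifts a (enum_val i) (enum_val j))%:R.
Proof.
move=> oX; rewrite /= summxE; case: (boolP (lifts _ _ _)) => [/existsP[b]|].
  case/and3P=> ba bs bt; rewrite (bigD1 b) //= mxE eq_sym bs eq_sym bt big1 ?addr0 //.
  move=> c /andP[ca cb]; rewrite mxE; case: andP => // -[/eqP cs _].
  by case/eqP: cb; apply: oX; rewrite ?(eqP ca) ?(eqP ba) // -cs (eqP bs).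
move/existsPn=> no; rewrite big1 // => b ba; rewrite mxE.
by have := no b; rewrite ba /= eq_sym [tgt b == _]eq_sym => /negPf->.
Qed.

Lemma enum_val_fiber X x (i : 'I_(#|fiber X x|)) : str0 (enum_val i) = x.
Proof. by have := enum_valP i; rewrite inE => /eqP. Qed.

Lemma fiber_enum_val X x (v : vert X) : str0 v = x ->
  exists i : 'I_(#|fiber X x|), enum_val i = v.
Proof.
move=> vx; have vf : v \in fiber X x by rewrite inE vx.
by exists (enum_rank_in vf v); rewrite enum_rankK_in.
Qed.

Lemma lin_iso X Y : out_det X -> out_det Y -> over_iso X Y ->
  rep_iso (L X) (L Y).
Proof.
move=> oX oY /over_iso_bij[f [[g0 fg0 gf0] [g1 fg1 gf1]]].
have [fs ft f0 f1] := homP f.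
apply: (@rep_iso_basis _ _ (vert Y) (L X) (L Y)
  (fun x i => (val f).1 (enum_val i)) (fun x i => enum_val i)).
- by move=> x i j /(can_inj fg0)/enum_val_inj.
- by move=> x; apply: enum_val_inj.
- by move=> x i; apply: fiber_enum_val; rewrite f0 enum_val_fiber.
- move=> x j; have [|i e] := @fiber_enum_val X x (g0 (enum_val j)).
    by rewrite -f0 gf0 enum_val_fiber.
  by exists i; rewrite e gf0.
move=> a i j i' j' ei ej; rewrite !lin_mapE // -ei -ej; congr (nat_of_bool _)%:R.
apply/existsP/existsP => -[b /and3P[/eqP ba /eqP bs /eqP bt]].
  by exists ((val f).2 b); rewrite f1 fs ft ba bs bt !eqxx.
exists (g1 b); rewrite -f1 gf1 ba eqxx /=.
by rewrite -!(can_eq fg0) -fs -ft gf1 bs bt !eqxx.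
Qed.

Lemma lin_closed Z (A : {set vert Z}) : closed_vert A -> out_det Z ->
  rep_iso (L Z) (rsum (L (restr A)) (L (restr (~: A)))).
Proof.
move=> cA oZ; have cA' := closed_vertC cA.
have oR (B : {set vert Z}) : out_det (restr B).
  by move=> b c /(congr1 val) es e1; apply: val_inj; apply: oZ.
have liftR (B : {set vert Z}) (a : arr Q) (u v : vert (restr B)) :
    closed_vert B -> lifts a u v = lifts a (val u) (val v).
  move=> cB; apply/existsP/existsP => -[b /and3P[/eqP ba /eqP bs /eqP bt]].
    by exists (val b); rewrite -ba -bs -bt !eqxx.
  have [|c cb] := restr_arr cB (b := b); first by rewrite bs (valP u).
  by exists c; rewrite -!val_eqE /= cb ba bs bt !eqxx.
pose bW x (i : 'I_(rdim (rsum (L (restr A)) (L (restr (~: A)))) x)) : vert Z :=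
  match split i with inl j => val (enum_val j) | inr j => val (enum_val j) end.
have bl x (j : 'I_(#|fiber (restr A) x|)) : @bW x (lshift _ j) = val (enum_val j).
  by rewrite /bW (unsplitK (inl j)).
have br x (j : 'I_(#|fiber (restr (~: A)) x|)) :
    @bW x (rshift _ j) = val (enum_val j).
  by rewrite /bW (unsplitK (inr j)).
have inA (u : vert (restr A)) : val u \in A by apply: valP.
have notA (u : vert (restr (~: A))) : val u \in A = false.
  by apply/negbTE; have := valP u; rewrite inE.
apply: (@rep_iso_basis _ _ (vert Z) (L Z) (rsum (L (restr A)) (L (restr (~: A))))
  (fun x i => enum_val i) bW).
- by move=> x; apply: enum_val_inj.
- move=> x i j; case: (split_ordP i) => i' ->; case: (split_ordP j) => j' ->;
    rewrite ?bl ?br => e.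
  + by congr lshift; apply/enum_val_inj/val_inj.
  + by have := inA (enum_val i'); rewrite e notA.
  + by have := inA (enum_val j'); rewrite -e notA.
  by congr rshift; apply/enum_val_inj/val_inj.
- move=> x i; case: (boolP (enum_val i \in A)) => iA.
    have [|j e] := @fiber_enum_val (restr A) x (exist _ (enum_val i) iA).
      exact: enum_val_fiber.
    by exists (lshift _ j); rewrite bl e.
  have iA' : enum_val i \in ~: A by rewrite inE.
  have [|j e] := @fiber_enum_val (restr (~: A)) x (exist _ (enum_val i) iA').
    exact: enum_val_fiber.
  by exists (rshift _ j); rewrite br e.
- move=> x j; apply: fiber_enum_val; rewrite /bW.
  by case: split => j'; apply: (enum_val_fiber j').
(* No arrow joins [A] to its complement, which accounts for the zero blocks of the direct sum. *)
have noC a (u v : vert Z) : (u \in A) != (v \in A) -> lifts a u v = false.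
  move=> uv; apply/existsP=> -[b /and3P[_ /eqP bs /eqP bt]].
  by move: uv; rewrite -bs -bt cA eqxx.
move=> a i j i' j' /= ei ej; rewrite [LHS]lin_mapE // ei ej.
case: (split_ordP i') => k ->; case: (split_ordP j') => l ->; rewrite ?bl ?br /=.
- by rewrite block_mxEul -liftR // -lin_mapE.
- by rewrite block_mxEur mxE noC // inA notA.
- by rewrite block_mxEdl mxE noC // inA notA.
by rewrite block_mxEdr -liftR // -lin_mapE.
Qed.

Lemma fibprod_out_det X Y : out_det X -> out_det Y -> out_det (fibprod X Y).
Proof.
move=> oX oY b c /fibprod_src[s1 s2] e.
by apply: fibprod_arr_inj; [apply: oX | apply: oY; rewrite // -!fibprod_str1].
Qed.

Lemma lifts_fibprod X Y (a : arr Q) (u v : vert (fibprod X Y)) :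
  lifts a u v = lifts a (val u).1 (val v).1 && lifts a (val u).2 (val v).2.
Proof.
apply/existsP/andP => [[b /and3P[/eqP ba /eqP bs /eqP bt]]|[/existsP[b] + /existsP[c]]].
  rewrite -bs -bt; split; apply/existsP.
    by exists (val b).1; rewrite -ba !eqxx.
  by exists (val b).2; rewrite -ba /= fibprod_str1 !eqxx.
move=> /and3P[/eqP ba /eqP bs /eqP bt] /and3P[/eqP ca /eqP cs /eqP ct].
have [|d [d1 d2]] := @fibprod_arr_exists Q X Y b c; first by rewrite ba ca.
exists d; apply/and3P; split; apply/eqP.
- by rewrite -ba -d1.
- by apply: fibprod_vert_inj; rewrite /= ?d1 ?d2.
by apply: fibprod_vert_inj; rewrite /= ?d1 ?d2.
Qed.

(** The vertex (u, v) corresponds to the tensor product of the basis vectors of u and v. A product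
    of two 0/1 entries is 1 exactly when both arrows lift, that is, when the pair lifts. *)
Lemma lin_fibprod X Y : out_det X -> out_det Y ->
  rep_iso (L (fibprod X Y)) (rtens (L X) (L Y)).
Proof.
move=> oX oY; have oXY := fibprod_out_det oX oY.
pose bW x (i : 'I_(rdim (rtens (L X) (L Y)) x)) : vert X * vert Y :=
  (enum_val (mxtens_unindex i).1, enum_val (mxtens_unindex i).2).
apply: (@rep_iso_basis _ _ (vert X * vert Y)%type (L (fibprod X Y)) (rtens (L X) (L Y))
  (fun x i => val (enum_val i)) bW).
- by move=> x i j e; apply/enum_val_inj/val_inj.
- move=> x i j; rewrite /= in i j *.
  case: (mxtens_indexP i) => u v; case: (mxtens_indexP j) => u' v'.
  by rewrite /bW !mxtens_indexK /= => -[/enum_val_inj-> /enum_val_inj->].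
- move=> x i; pose w := enum_val i; have wx : str0 w = x := enum_val_fiber i.
  have [u uE] := @fiber_enum_val X x (val w).1 wx.
  have [|v vE] := @fiber_enum_val Y x (val w).2; first by rewrite -(eqP (valP w)).
  exists (mxtens_index (u, v)); rewrite /bW mxtens_indexK /= uE vE.
  by rewrite -surjective_pairing.
- move=> x j; rewrite /bW; case: (mxtens_unindex j) => u v /=.
  have [|w [w1 w2]] := @fibprod_vert_exists Q X Y (enum_val u) (enum_val v).
    by rewrite !enum_val_fiber.
  have [|i iE] := @fiber_enum_val (fibprod X Y) x w.
    by rewrite /= w1 enum_val_fiber.
  by exists i; rewrite iE -w1 -w2 -surjective_pairing.
move=> a i j i' j' ei ej; rewrite lin_mapE //= mxE !lin_mapE // -natrM mulnb.
by rewrite lifts_fibprod ei ej.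
Qed.

(** * The terminal object *)

Lemma full_strP : @is_qmor Q Q id id.
Proof. by apply/forallP=> a; rewrite !eqxx. Qed.

(** The terminal quiver over [Q]: it linearizes to the unit and all its marks are 1. *)
Definition full_over : quiver_over Q := QuiverOver full_strP.

Lemma full_embedded : embedded full_over.
Proof. by split. Qed.

Lemma card_hom_full X : #|over_hom X full_over| = 1%N.
Proof.
have fP : @is_hom Q X full_over (@str0 Q X) (@str1 Q X).
  by split=> // b; rewrite ?str_src ?str_tgt.
rewrite -cardsT; apply/eqP/cards1P; exists (mk_hom fP); apply/setP=> g.
rewrite !inE; apply/esym/eqP; have [_ _ g0 g1] := homP g.
by apply: hom_ext => u; rewrite /= ffunE -?g0 -?g1.
Qed.

Lemma lin_full : rep_iso (L full_over) (rone K Q).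
Proof.
have [_ oF] := full_embedded.
apply: (@rep_iso_basis _ _ (vert Q) (L full_over) (rone K Q)
  (fun x i => enum_val i) (fun x _ => x)).
- by move=> x; apply: enum_val_inj.
- by move=> x i j _; rewrite [i]ord1 [j]ord1.
- by move=> x i; exists 0; apply/esym/(@enum_val_fiber full_over x i).
- by move=> x j; apply: fiber_enum_val.
move=> a i j i' j' ei ej; rewrite lin_mapE //= mxE [i']ord1 [j']ord1 ei ej.
rewrite (_ : lifts _ _ _) //; apply/existsP; exists a; by rewrite !eqxx.
Qed.

End Linearization.

(** * Marks and idempotents *)

Section Marks.
Variables (R : comPzRingType) (I : finType) (l : I -> R) (m mu : I -> I -> int).
Hypothesis m_mu : forall w y, \sum_z m w z * mu z y = (w == y)%:R.
Hypothesis mu_m : forall x z, \sum_w mu x w * m w z = (x == z)%:R.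
(** The family [l] may be linearly dependent in [R], so marks belong to coefficients: a single [c]
    has to give both the product and its marks. *)
Hypothesis l_mul : forall a b, exists2 c : I -> int,
  l a * l b = \sum_z l z *~ c z & forall w, m w a * m w b = \sum_z m w z * c z.
Hypothesis l_one : exists2 c : I -> int,
  1 = \sum_z l z *~ c z & forall w, 1 = \sum_z m w z * c z.

Definition mark_idem (x : I) : R := \sum_z l z *~ mu z x.

(** Inversion of the table of marks: the coefficient of a combination at [mark_idem w] is its mark
    at [w]. *)
Lemma mark_idemE (c : I -> int) :
  \sum_z l z *~ c z = \sum_w mark_idem w *~ \sum_z m w z * c z.
Proof.
pose p z w := l z *~ (mu z w * \sum_y m w y * c y).
transitivity (\sum_z \sum_w p z w).
  apply: eq_bigr => z _; rewrite -mulrz_sumr; congr (_ *~ _).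
  transitivity (\sum_y (z == y)%:R * c y).
    by rewrite (bigD1 z) //= eqxx mul1r big1 ?addr0 // => y yz;
      rewrite eq_sym (negPf yz) mul0r.
  transitivity (\sum_y \sum_w mu z w * m w y * c y).
    by apply: eq_bigr => y _; rewrite -mu_m mulr_suml.
  rewrite exchange_big; apply: eq_bigr => w _; rewrite mulr_sumr.
  by apply: eq_bigr => y _; rewrite mulrA.
rewrite exchange_big; apply: eq_bigr => w _; rewrite mulrz_suml.
by apply: eq_bigr => z _; rewrite /p mulrzA.
Qed.

Lemma mark_idem_sum : \sum_x mark_idem x = 1.
Proof.
have [c -> c1] := l_one; rewrite mark_idemE.
by apply: eq_bigr => w _; rewrite -c1.
Qed.

Lemma mark_idem_mul x y : mark_idem x * mark_idem y = mark_idem x *+ (x == y).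
Proof.
(* [s z w] is the mark at [w] of [mark_idem z], which [m_mu] evaluates to an indicator function. *)
pose s z w := \sum_a m w a * mu a z.
transitivity (\sum_w mark_idem w *~ (s x w * s y w)); last first.
  rewrite (bigD1 x) //= /s !m_mu eqxx mul1r big1 => [|w wx].
    by rewrite addr0; case: eqP.
  by rewrite !m_mu (negPf wx) mul0r mulr0z.
rewrite {1 2}/mark_idem mulr_suml.
transitivity (\sum_a \sum_b \sum_w
    mark_idem w *~ ((m w a * mu a x) * (m w b * mu b y))).
  apply: eq_bigr => a _; rewrite mulr_sumr; apply: eq_bigr => b _.
  rewrite mulrzAl mulrzAr -mulrzA; have [c -> cE] := l_mul a b.
  rewrite mark_idemE mulrz_suml; apply: eq_bigr => w _.
  by rewrite -cE -mulrzA; congr (_ *~ _); rewrite [mu b y * _]mulrC mulrACA.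
under eq_bigr => a _ do rewrite exchange_big.
rewrite exchange_big; apply: eq_bigr => w _ /=.
rewrite /s mulr_suml mulrz_sumr; apply: eq_bigr => a _.
by rewrite mulr_sumr mulrz_sumr.
Qed.

End Marks.

(** * Peirce decomposition along orthogonal idempotents *)

Lemma prod_subE (I : finType) (A : I -> comPzRingType) (f g : prod_ring A) i :
  (f - g) i = f i - g i.
Proof. by rewrite [LHS]ffunE ffunE. Qed.

Lemma prod_mulE (I : finType) (A : I -> comPzRingType) (f g : prod_ring A) i :
  (f * g) i = f i * g i.
Proof. by rewrite [LHS]ffunE. Qed.

Lemma prod_oneE (I : finType) (A : I -> comPzRingType) i :
  (1 : prod_ring A) i = 1.
Proof. by rewrite [LHS]ffunE. Qed.

Section Peirce.
Variables (R : comPzRingType) (I : finType) (e : I -> R).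
Hypothesis idem : forall x, e x * e x = e x.
Hypothesis orth : forall x y, x != y -> e x * e y = 0.
Hypothesis sum1 : \sum_x e x = 1.

Lemma mem_principal_ideal (a : R) x : a * e x \in principal_ideal (e x).
Proof. by apply/asboolP; exists a. Qed.

Definition peirce (a : R) : prod_ring (fun x => ideal_ring (idem x)) :=
  [ffun x => Sub (a * e x) (mem_principal_ideal a x) : ideal_ring (idem x)].

Lemma peirceE a x : val (peirce a x) = a * e x.
Proof. by rewrite ffunE. Qed.

Lemma peirce_zmod_morphism : zmod_morphism peirce.
Proof.
move=> a b; apply/ffunP=> x; apply: val_inj; rewrite peirceE mulrBl -!peirceE.
by rewrite prod_subE.
Qed.

Lemma peirce_monoid_morphism : monoid_morphism peirce.
Proof.
split=> [|a b]; apply/ffunP=> x; apply: val_inj; rewrite peirceE.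
  by rewrite mul1r prod_oneE.
by rewrite prod_mulE /= -!/(val _) !peirceE mulrACA idem.
Qed.

HB.instance Definition _ :=
  GRing.isZmodMorphism.Build R _ peirce peirce_zmod_morphism.
HB.instance Definition _ :=
  GRing.isMonoidMorphism.Build R _ peirce peirce_monoid_morphism.

Lemma peirce_bij : bijective peirce.
Proof.
(* The inverse adds the components; multiplying the sum by [e x] kills all of them but the one at
   [x]. *)
exists (fun s : prod_ring (fun x => ideal_ring (idem x)) => \sum_x val (s x)) => [a|s].
  by under eq_bigr => x _ do rewrite peirceE; rewrite -mulr_sumr sum1 mulr1.
apply/ffunP=> x; apply: val_inj; rewrite peirceE mulr_suml (bigD1 x) //=.
rewrite big1 => [|y yx]; rewrite ?addr0.
  by have /asboolP[a ->] := valP (s x); rewrite -mulrA idem.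
by have /asboolP[a ->] := valP (s y); rewrite -mulrA orth // mulr0.
Qed.

End Peirce.

(* Along a permutation, [r] cannot increase weakly everywhere and strictly
   somewhere, so only the identity contributes to the determinant. *)
Lemma unitriangular_unitmx (R : comUnitRingType) n (M : 'M[R]_n) (r : 'I_n -> nat) :
    (forall i, M i i = 1) ->
    (forall i j, i != j -> M i j != 0 -> (r i < r j)%N) ->
  M \in unitmx.
Proof.
move=> M1 Mlt; rewrite unitmxE; suff -> : \det M = 1 by rewrite unitr1.
rewrite /determinant (bigD1 (1%g : 'S_n)) //= odd_perm1 mul1r.
rewrite big1 => [|i _]; last by rewrite perm1.
rewrite big1 ?addr0 // => s s1.
suff [i /eqP Mi] : exists i, M i (s i) == 0 by rewrite (bigD1 i) //= Mi mul0r mulr0.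
apply/existsP; apply: contraR s1 => /existsPn nz.
have le i : (r i <= r (s i))%N.
  by case: (eqVneq i (s i)) => [<-//|/Mlt/(_ (nz i))/ltnW].
apply/eqP/permP=> i; rewrite perm1; apply/eqP/negPn/negP=> si.
have : (\sum_j r j < \sum_j r (s j))%N.
  rewrite (bigD1 i) // [X in (_ < X)%N](bigD1 i) //= -addSn; apply: leq_add.
    by apply: Mlt; rewrite // eq_sym.
  by apply: leq_sum => j _.
by rewrite [X in (_ < X)%N -> _](_ : _ = \sum_j r j)%N ?ltnn // [RHS](reindex_perm s).
Qed.

(** * Decomposition of quivers over Q into objects of PIE *)

Section Decomposition.
Variables (K : fieldType) (Q : quiver) (acQ : acyclic Q).
Implicit Types X Y Z : quiver_over Q.

Lemma pie_class_out_det X : pie_class X -> out_det X.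
Proof.
case=> [[_ []]|[/in_deg1_op d _]|[_ X1]|[_ /in_deg1_op d]] //.
- by move=> b c /d.
- by move=> b c _ /X1.
by move=> b c /d.
Qed.

Lemma pie_class_in_det X : pie_class X -> in_det X.
Proof.
case=> [[d _]|[_ /out_sat_op[]]|[_ X1]|[d _]] //.
- by move=> b c /d.
- by move=> b c _ /X1.
by move=> b c /d.
Qed.

Lemma pie_name_class (c : pie_name Q) : pie_class (named_obj c).
Proof.
by case: (named_class acQ c) => H; [constructor 1|constructor 2|constructor 3].
Qed.

(** Two factors of one kind give that kind, a factor [E_T] preserves the kind of the other, and
    [P_T] with [I_S] gives at most one arrow into and out of each vertex. *)
Lemma pie_class_fibprod (c d : pie_name Q) :
  pie_class (fibprod (named_obj c) (named_obj d)).
Proof.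
have [cc cd] := (pie_name_class c, pie_name_class d).
have [ic oc] := (pie_class_in_det cc, pie_class_out_det cc).
have [id od] := (pie_class_in_det cd, pie_class_out_det cd).
case: (named_class acQ c) => [[dc sc]|[dc sc]|ec];
  case: (named_class acQ d) => [[dd sd]|[dd sd]|ed].
- by constructor 1; split; [apply: fibprod_in_deg1l | apply: fibprod_out_sat].
- by constructor 4; split; [apply: fibprod_in_deg1l | apply: fibprod_op_in_deg1r].
- constructor 1; split; [exact: fibprod_in_deg1l | apply: fibprod_out_sat] => //.
  exact: embedded_out_sat.
- by constructor 4; split; [apply: fibprod_in_deg1r | apply: fibprod_op_in_deg1l].
- by constructor 2; split; [apply: fibprod_op_in_deg1l | apply: fibprod_op_out_sat].
- constructor 2; split; [exact: fibprod_op_in_deg1l | apply: fibprod_op_out_sat] => //.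
  exact/embedded_out_sat/embedded_op.
- constructor 1; split; [exact: fibprod_in_deg1r | apply: fibprod_out_sat] => //.
  exact: embedded_out_sat.
- constructor 2; split; [exact: fibprod_op_in_deg1r | apply: fibprod_op_out_sat] => //.
  exact/embedded_out_sat/embedded_op.
by constructor 3; apply: fibprod_embedded.
Qed.

Definition pie_of_name (c : pie_name Q) : PIE0 Q := \pi_(PIE0 Q) c.

Lemma pie_of_name_iso (c : pie_name Q) :
  over_iso (named_obj c) (pie_obj (pie_of_name c)).
Proof.
suff : name_iso c (repr (pie_of_name c)) by [].
by apply/eqmodP; rewrite reprK.
Qed.

Lemma pie_obj_inj (x y : PIE0 Q) : over_iso (pie_obj x) (pie_obj y) -> x = y.
Proof. by move=> xy; rewrite -[x]reprK -[y]reprK; apply/eqmodP. Qed.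

(** A nonempty closed set of least size is a connected component: a nonempty closed set of vertices
    of the restriction is also closed in [Z], hence is everything by minimality. *)
Lemma min_closed_vert Z (v : vert Z) : exists A : {set vert Z},
  [/\ closed_vert A, A != set0 & conn (restr A)].
Proof.
pose P (A : {set vert Z}) :=
  (A != set0) && [forall b : arr Z, (src b \in A) == (tgt b \in A)].
have PT : P setT.
  by apply/andP; split; [apply/set0Pn; exists v | apply/forallP=> b; rewrite !inE].
case: (arg_minnP (fun A : {set vert Z} => #|A|) PT) => A /andP[A0 /forallP cA] minA.
have {}cA : closed_vert A by move=> b; apply/eqP/cA.
exists A; split=> // B cB u w uB.
pose B' : {set vert Z} := [set val x | x in B].
have inB (x : vert (restr A)) : (val x \in B') = (x \in B).
  by apply: mem_imset; apply: val_inj.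
have B'A : B' \subset A by apply/subsetP=> _ /imsetP[x _ ->]; apply: valP.
have cB' : closed_vert B'.
  move=> b; apply/idP/idP => bB.
    have [c cb] := restr_arr cA (subsetP B'A _ bB); move: bB.
    by rewrite -cb -[src _]/(val (src c)) -[tgt _]/(val (tgt c)) !inB cB.
  have bA : src b \in A by rewrite cA (subsetP B'A).
  have [c cb] := restr_arr cA bA; move: bB.
  by rewrite -cb -[src _]/(val (src c)) -[tgt _]/(val (tgt c)) !inB cB.
have PB : P B'.
  apply/andP; split; last by apply/forallP=> b; rewrite cB'.
  by apply/set0Pn; exists (val u); rewrite inB.
have /eqP B'E : B' == A by rewrite eqEcard B'A minA.
by rewrite -inB B'E; apply: valP.
Qed.

Local Notation hom w z := (#|over_hom (pie_obj w) (pie_obj z)|%:Z).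
Local Notation cls X := (rep_class (linearization K X)).

(** Induction on the number of vertices, splitting off one component [A] at a time. Classes and
    marks are both additive, so the same coefficients, counting components of each type, serve
    both. *)
Lemma decomposition Z : pie_class Z -> exists2 c : PIE0 Q -> int,
  cls Z = \sum_z cls (pie_obj z) *~ c z &
  forall w, #|over_hom (pie_obj w) Z|%:Z = \sum_z hom w z * c z.
Proof.
have [n] := ubnP #|vert Z|; elim: n Z => // n IH Z Zn clZ.
case: (pickP (xpredT : pred (vert Z))) => [v _|no].
  have [A [cA A0 connA]] := min_closed_vert v.
  have cA' := closed_vertC cA.
  have clA := restr_pie_class cA clZ; have clA' := restr_pie_class cA' clZ.
  have [|c cE cM] := IH (restr (~: A)) _ clA'.
    rewrite card_sig (leq_trans _ (_ : #|vert Z| <= n)%N) //.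
    rewrite -(cardsC A) -[X in (X < _)%N]add0n (_ : #|_| = #|~: A|) //.
    by rewrite ltn_add2r card_gt0.
  have [a aA] := set0Pn _ A0.
  have [d dA] := pie_class_named acQ clA connA (exist _ a aA).
  pose y := pie_of_name d.
  have yA : over_iso (restr A) (pie_obj y).
    exact: over_iso_trans dA (pie_of_name_iso d).
  exists (fun z => (z == y)%:R + c z) => [|w].
    rewrite (rep_class_iso (lin_closed K cA (pie_class_out_det clZ))).
    rewrite rep_class_sum cE.
    under [RHS]eq_bigr => z _ do rewrite mulrzDr.
    rewrite big_split /=; congr (_ + _).
    rewrite (bigD1 y) //= eqxx mulr1z big1 ?addr0; last first.
      by move=> z /negPf->; rewrite mulr0z.
    apply/rep_class_iso/lin_iso => //; first exact: pie_class_out_det.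
    exact/pie_class_out_det/pie_name_class.
  have [wi wc _] := named_conn acQ (repr w).
  rewrite (card_hom_closed cA wi wc) PoszD cM.
  under [RHS]eq_bigr => z _ do rewrite mulrDr.
  rewrite big_split /=; congr (_ + _).
  rewrite (bigD1 y) //= eqxx mulr1 big1 ?addr0; last first.
    by move=> z /negPf->; rewrite mulr0.
  by rewrite (card_hom_iso _ yA).
(* The empty quiver has class zero and receives no morphism from the nonempty objects of PIE. *)
exists (fun _ => 0) => [|w].
  rewrite big1 => [|z _]; last by rewrite mulr0z.
  by apply: rep_class_empty => x; apply: eq_card0 => v; have := no v.
rewrite big1 => [|z _]; last by rewrite mulr0.
congr Posz; apply: eq_card0 => f; have [[w0] _ _] := named_conn acQ (repr w).
by have := no ((val f).1 w0).
Qed.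

(** Existence of a morphism is a partial order on [PIE0], antisymmetric because endomorphisms are
    trivial. The number of objects below a given one increases strictly along it, and the diagonal
    entries are 1. *)
Lemma hom_matrix_unit : hom_matrix Q \in unitmx.
Proof.
pose le (x y : PIE0 Q) := (0 < #|over_hom (pie_obj x) (pie_obj y)|)%N.
have le_refl x : le x x.
  by apply/card_gt0P; exists (id_hom (pie_obj x)).
have le_trans x y z : le x y -> le y z -> le x z.
  by case/card_gt0P=> f _ /card_gt0P[g _]; apply/card_gt0P; exists (comp_hom f g).
have endo (x : PIE0 Q) : endo_trivial (pie_obj x) by have [] := named_conn acQ (repr x).
have le_anti x y : le x y -> le y x -> x = y.
  case/card_gt0P=> f _ /card_gt0P[g _]; apply: pie_obj_inj.
  exact: endo_trivial_iso f g (endo x) (endo y).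
apply: (@unitriangular_unitmx _ _ _ (fun i => #|[set z | le z (enum_val i)]|)).
  by move=> i; rewrite mxE card_endo.
move=> i j ij; rewrite mxE => nz.
have lij : le (enum_val i) (enum_val j) by rewrite /le lt0n.
apply/proper_card/properP; split.
  by apply/subsetP=> z; rewrite !inE => /le_trans; apply.
exists (enum_val j); rewrite !inE ?le_refl //; apply: contra ij => lji.
by apply/eqP/enum_val_inj/le_anti.
Qed.

Lemma hom_mobius (w y : PIE0 Q) : \sum_z hom w z * mobius z y = (w == y)%:R.
Proof.
have := mulmxV hom_matrix_unit => /matrixP/(_ (enum_rank w) (enum_rank y)).
rewrite !mxE (can_eq enum_rankK) => <-; rewrite (reindex_onto enum_val enum_rank) /=.
  by apply: eq_big => [i|i _]; rewrite ?enum_valK ?eqxx //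
    mxE enum_rankK /mobius enum_valK.
by move=> z _; rewrite enum_rankK.
Qed.

Lemma mobius_hom (x z : PIE0 Q) : \sum_w mobius x w * hom w z = (x == z)%:R.
Proof.
have := mulVmx hom_matrix_unit => /matrixP/(_ (enum_rank x) (enum_rank z)).
rewrite !mxE (can_eq enum_rankK) => <-; rewrite (reindex_onto enum_val enum_rank) /=.
  by apply: eq_big => [i|i _]; rewrite ?enum_valK ?eqxx //
    mxE enum_rankK /mobius enum_valK.
by move=> w _; rewrite enum_rankK.
Qed.

(** The coefficient of [z] in [delta x] is [mobius z x]. *)
Lemma pie_idemE (x : PIE0 Q) :
  pie_idem K x = mark_idem (fun z => cls (pie_obj z)) (@mobius Q) x.
Proof.
apply: eq_bigr => z _; congr (_ *~ _); rewrite /delta.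
rewrite raddf_sum /=; under eq_bigr => y _ do rewrite coeffU.
rewrite (bigD1 z) //= eqxx mulr1 big1 ?addr0 // => y /negPf->.
by rewrite mulr0.
Qed.

Lemma decomposition_mul (a b : PIE0 Q) : exists2 c : PIE0 Q -> int,
  cls (pie_obj a) * cls (pie_obj b) = \sum_z cls (pie_obj z) *~ c z &
  forall w, hom w a * hom w b = \sum_z hom w z * c z.
Proof.
have [c cE cM] := decomposition (pie_class_fibprod (repr a) (repr b)).
exists c => [|w].
  rewrite -rep_class_tens -cE; apply/esym/rep_class_iso/lin_fibprod;
  exact/pie_class_out_det/pie_name_class.
by rewrite -cM card_hom_fibprod PoszM.
Qed.

Lemma decomposition_one : exists2 c : PIE0 Q -> int,
  1 = \sum_z cls (pie_obj z) *~ c z & forall w, 1 = \sum_z hom w z * c z.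
Proof.
have fullP : pie_class (full_over Q) by constructor 3; apply: full_embedded.
have [c cE cM] := decomposition fullP; exists c => [|w].
  by rewrite -cE (rep_class_iso (lin_full K Q)).
by rewrite -cM card_hom_full.
Qed.

End Decomposition.

Theorem theorem2 (K : fieldType) (Q : quiver) (acyclicQ : acyclic Q) :
  exists idem : forall x : PIE0 Q, pie_idem K x * pie_idem K x = pie_idem K x,
  exists f : {rmorphism repring K Q -> prod_ring (fun x => ideal_ring (idem x))},
    bijective f.
Proof.
have mulE (x y : PIE0 Q) : pie_idem K x * pie_idem K y = pie_idem K x *+ (x == y).
  rewrite !pie_idemE.
  exact: mark_idem_mul (hom_mobius acyclicQ) (mobius_hom acyclicQ)
    (decomposition_mul K acyclicQ) x y.
have idem (x : PIE0 Q) : pie_idem K x * pie_idem K x = pie_idem K x.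
  by rewrite mulE eqxx.
have orth (x y : PIE0 Q) : x != y -> pie_idem K x * pie_idem K y = 0.
  by move=> /negPf xy; rewrite mulE xy.
have sum1 : \sum_(x : PIE0 Q) pie_idem K x = 1.
  under eq_bigr => x _ do rewrite pie_idemE.
  exact: mark_idem_sum (mobius_hom acyclicQ) (decomposition_one K acyclicQ).
exists idem, (peirce idem : {rmorphism _ -> _}).
exact: peirce_bij.
Qed.
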